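(* Let $d\ge 1$, $p\ge 1$, $n>0$, and let $\overline{q}\ge 4$ be an even integer. There exists $\rho=\rho(\overline{q},d)>0$ such that the following holds. If for some $q>3$ with $|q-\overline{q}|<\rho$ there exists $c_{q,d}>0$ such that $$\|\widehat{e^{ig}1_{\mathbb{B}}}\|_q^q\le\|\widehat{1_{\mathbb{B}}}\|_q^q-c_{q,d}\inf_{L}\|e^{i(g-L)}-1\|_{L^p(\mathbb{B})}^n$$ for every measurable function $g:\mathbb{R}^d\to\mathbb{R}$, where the infimum is over all affine functions $L:\mathbb{R}^d\to\mathbb{R}$, then $n\ge 2$.
   Context: The Fourier transform is $\widehat{f}(\xi)=\int_{\mathbb{R}^d}e^{-2\pi i x\cdot\xi}f(x)\,dx$, and $\mathbb{B}$ is the unit ball of $\mathbb{R}^d$ centered at the origin. Here $p$ is an arbitrary exponent, not the conjugate of $q$. *)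

(* Defs.v *)
From HB Require Import structures.
From mathcomp Require Import all_boot all_order all_algebra.
From mathcomp Require Import complex.
From mathcomp Require Import all_classical all_reals all_analysis.

Set Implicit Arguments.
Unset Strict Implicit.
Unset Printing Implicit Defensive.

Import Order.TTheory GRing.Theory Num.Theory.
Import numFieldNormedType.Exports.

Local Open Scope classical_set_scope.
Local Open Scope complex_scope.
Local Open Scope ring_scope.

(* R^d as d-tuples, with the sigma-algebra generated by the coordinates,
   i.e. the Borel sigma-algebra. *)
Notation Rd R d := (d.-tuple (measurableTypeR R)).

Section lebesgue_Rd.
Context {R : realType}.

Definition consRd d (x : measurableTypeR R * Rd R d) : Rd R d.+1 :=
  [tuple of x.1 :: x.2].

Lemma measurable_consRd d : measurable_fun setT (@consRd d).
Proof. exact: measurable_cons. Qed.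

HB.instance Definition _ d := isMeasurableFun.Build _ _ _ _ (@consRd d)
  (@measurable_consRd d).

Lemma behead_consRd d x (y : Rd R d) : [tuple of behead (consRd (x, y))] = y.
Proof. exact: val_inj. Qed.

Section step.
Context d (mu : {sigma_finite_measure set (Rd R d) -> \bar R}).

Definition lebesgueS : set (Rd R d.+1) -> \bar R :=
  pushforward (lebesgue_measure \x mu)%E (@consRd d).

Let lebesgueS0 : lebesgueS set0 = 0%E.
Proof. exact: measure0. Qed.

Let lebesgueS_ge0 A : (0 <= lebesgueS A)%E.
Proof. exact: measure_ge0. Qed.

Let lebesgueS_sigma_additive : semi_sigma_additive lebesgueS.
Proof. exact: measure_semi_sigma_additive. Qed.

HB.instance Definition _ := isMeasure.Build _ _ _ lebesgueS
  lebesgueS0 lebesgueS_ge0 lebesgueS_sigma_additive.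

Let lebesgueS_sigma_finite : sigma_finite setT lebesgueS.
Proof.
have /sigma_finiteP[F [TF ndF Foo]] := sigma_finiteT (@lebesgue_measure R).
have /sigma_finiteP[G [TG ndG Goo]] := sigma_finiteT mu.
exists (fun n => [set x | F n (thead x) /\ G n [tuple of behead x]]).
  apply/seteqP; split => // x _.
  have : setT (thead x) by []. rewrite TF => -[m _ Fm].
  have : setT ([tuple of behead x] : Rd R d) by [].
  rewrite TG => -[n _ Gn].
  exists (maxn m n) => //; split.
    by move: Fm; exact/subsetPset/ndF/leq_maxl.
  by move: Gn; exact/subsetPset/ndG/leq_maxr.
move=> n; have [mF Fn] := Foo n; have [mG Gn] := Goo n; split.
  apply: measurableI; rewrite -[X in measurable X]setTI.
    exact: measurable_tnth.
  exact: measurable_behead.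
rewrite /lebesgueS /pushforward (_ : _ @^-1` _ = F n `*` G n).
  by rewrite product_measure1E// lte_mul_pinfty// ge0_fin_numE.
by apply/seteqP; split => -[x y] /=; rewrite behead_consRd.
Qed.

HB.instance Definition _ := Measure_isSigmaFinite.Build _ _ _
  lebesgueS lebesgueS_sigma_finite.

End step.

(* Lebesgue measure on R^d, as the d-fold product of Lebesgue measure on R:
   the (d+1)-dimensional measure is the image of (lebesgue_measure \x lambda_d)
   under (t, x) |-> t :: x, and lambda_0 is the unit mass on the point R^0. *)
Fixpoint lebesgue_Rd d : {sigma_finite_measure set (Rd R d) -> \bar R} :=
  match d with
  | 0 => \d_([tuple] : Rd R 0)
  | d.+1 => lebesgueS (lebesgue_Rd d)
  end.

End lebesgue_Rd.

Section fourier.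
Context {R : realType}.

Definition dotp d (x y : Rd R d) : R :=
  \sum_(i < d) (tnth x i : R) * (tnth y i : R).

(* The closed Euclidean ball; its boundary is Lebesgue-null, so the open ball
   gives the same integrals. *)
Definition unit_ball d : set (Rd R d) := [set x | Num.sqrt (dotp x x) <= 1].

Definition affine d (L : Rd R d -> R) : Prop :=
  exists (a : Rd R d) (b : R), forall x, L x = dotp a x + b.

Definition expi (t : R) : R[i] := cos t +i* sin t.

Definition charC d (A : set (Rd R d)) (x : Rd R d) : R[i] := (\1_A x)%:C.

(* Junk value if f is not integrable; only used for bounded f supported in the
   unit ball. *)
Definition Cintegral d (f : Rd R d -> R[i]) : R[i] :=
  (\int[lebesgue_Rd d]_x complex.Re (f x)) +i*
  (\int[lebesgue_Rd d]_x complex.Im (f x)).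

Definition fourier d (f : Rd R d -> R[i]) (xi : Rd R d) : R[i] :=
  Cintegral (fun x => expi (- (2 * pi * dotp x xi)) * f x).

(* The L^p(A) norm for p > 0: the indicator cuts the integral down to A. *)
Definition LnormC d (A : set (Rd R d)) (p : R) (f : Rd R d -> R[i]) : \bar R :=
  Lnorm (lebesgue_Rd d) p%:E
    (fun x => (ComplexField.Normc.normc (f x) * \1_A x)%:E).

End fourier.

(* Main.v *)
Require Import Defs.
From HB Require Import structures.
From mathcomp Require Import all_boot all_order all_algebra.
From mathcomp Require Import complex.
From mathcomp Require Import all_classical all_reals all_analysis.
From mathcomp Require Import ring lra measurable_realfun.
Import Order.TTheory GRing.Theory Num.Theory.
Import numFieldNormedType.Exports.

(** Perturb the ball by g = delta 1_E and by -g, where E is the strip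
    0 <= x_0 < 1/6.  The terms of order one in delta cancel in the sum of the
    two transforms, which is 2 (1_B - (1 - cos g) 1_B)^.  With z = |1_B^| and
    w, w' the moduli of the two transforms this gives w + w' >= 2 z - O(delta^2),
    and the tangent inequality for t |-> t^q yields
      w^q + w'^q >= 2 z^q - O(delta^2) z^(q - 1).
    Since q - 1 > 2 and z is bounded, the integral of z^(q - 1) is controlled by
    that of z^2, which is finite: this is where q > 3 is used.

    On the other side, phi = +-g - L satisfies
    phi(x) - 2 phi(x + h e_0) + phi(x + 2 h e_0) = +-delta on the strip, for
    every affine L, so that the infimum is at least a constant times
    |e^(i delta) - 1|^n.  As 1 - cos delta = |e^(i delta) - 1|^2 / 2, letting
    delta tend to 0 forces n >= 2.

    Square integrability of the transform of a bounded function supported in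
    [-1, 1]^d is proved by induction on d.  On the line, Bessel's inequality
    bounds the sum of the squares of the transform over every progression
    b + k/2, and integrating over b tiles the line. *)

Local Open Scope classical_set_scope.
Local Open Scope ring_scope.

(** * Integrals on the line *)

Lemma bounded_integrable {d} {T : measurableType d} {R : realType}
    (mu : {measure set T -> \bar R}) (D : set T) (f : T -> R) (M : R) :
  measurable D -> (mu D < +oo)%E -> measurable_fun D f ->
  (forall x, D x -> `|f x| <= M) -> mu.-integrable D (EFin \o f).
Proof.
move=> mD muD mf fM; apply: measurable_bounded_integrable => //.
exists M; split; first exact: num_real.
by move=> y My x Dx /=; apply: le_trans (ltW My); exact: fM.
Qed.

Lemma Rintegral_sum {d} {T : measurableType d} {R : realType}
    (mu : {measure set T -> \bar R}) (D : set T) (I : Type) (s : seq I)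
    (f : I -> T -> R) :
  measurable D -> (forall i, mu.-integrable D (EFin \o f i)) ->
  \int[mu]_(x in D) (\sum_(i <- s) f i x) = \sum_(i <- s) \int[mu]_(x in D) f i x.
Proof.
move=> mD intf; elim: s => [|i s IH].
  by under eq_Rintegral do rewrite big_nil; rewrite big_nil Rintegral_cst// mul0r.
under eq_Rintegral do rewrite big_cons; rewrite big_cons -IH RintegralD//.
rewrite (_ : _ \o _ = (fun x => \sum_(i <- s) (f i x)%:E)%E).
  by apply: integrable_sum => // i0 _; exact: intf.
by apply/funext => x /=; rewrite sumEFin.
Qed.

Section line.
Context {R : realType}.
Notation mu := (@lebesgue_measure R).

(** By uniqueness of Lebesgue measure: a translate of it gives half-open intervals the same
    length. *)
Lemma lebesgue_measure_shift (a : R) (A : set R) : measurable A ->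
  pushforward mu ((fun x => x + a) : _ -> measurableTypeR R) A = mu A.
Proof.
move=> mA; apply/esym/lebesgue_measure_unique => //=.
  by move=> _; exact: measurable_funD.
move=> _ _ [[u v]] _ <-; rewrite /pushforward.
rewrite (_ : _ @^-1` _ = `]u - a, v - a]%classic); last first.
  by apply/seteqP; split => x /=; rewrite !in_itv/= ltrBlDr lerBrDr.
by rewrite !lebesgue_measure_itv/= !lte_fin ltrD2r -!EFinB; case: ifP => // _;
  congr EFin; lra.
Qed.

Lemma ge0_integral_shift (a : R) (D : set (measurableTypeR R))
    (f : measurableTypeR R -> \bar R) :
  measurable D -> measurable_fun D f -> (forall x, D x -> (0 <= f x)%E) ->
  (\int[mu]_(x in D) f x = \int[mu]_(x in [set x | D (x + a)%R]) f (x + a)%R)%E.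
Proof.
move=> mD mf f0.
have ms : measurable_fun setT ((fun x => x + a) : measurableTypeR R ->
  measurableTypeR R).
  exact: measurable_funD.
rewrite -[RHS](@ge0_integral_pushforward _ _ _ _ _ _ ms)//.
  by apply: eq_measure_integral => //= A mA AS; exact/esym/lebesgue_measure_shift.
by move=> x /set_mem; exact: f0.
Qed.

Notation I := (`[(-1 : R), 1]%classic).

Lemma lebesgue_measure_itvNcc (r : R) : 0 <= r -> mu `[- r, r]%classic = (2 * r)%:E.
Proof.
move=> r0; rewrite lebesgue_measure_itv/= lte_fin.
by case: ltP => [_|rr]; rewrite -?EFinB; congr EFin; lra.
Qed.

Lemma lebesgue_measure_itvN11 : mu I = 2%:E.
Proof. by rewrite lebesgue_measure_itvNcc// mulr1. Qed.

(** The antiderivative [m^-1 * sin (m * x)] vanishes at both ends. The case needed is that of a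
    nonzero multiple of pi, the gap between two Bessel frequencies. *)
Lemma Rintegral_cos (m : R) : m != 0 -> sin m = 0 ->
  \int[mu]_(x in I) cos (m * x) = 0.
Proof.
move=> m0 sm.
have dF (x : R) : is_derive x (1 : R) (fun x : R => m^-1 * sin (m * x)) (cos (m * x)).
  by apply: is_derive_eq; rewrite /GRing.scale/=; field.
have cF : continuous (fun x : R => m^-1 * sin (m * x)).
  by move=> x; apply/differentiable_continuous/derivable1_diffP; case: (dF x).
rewrite /Rintegral (@continuous_FTC2 _ _ (fun x => m^-1 * sin (m * x)))//=.
- by rewrite !mulrN mulr1 sinN sm oppr0 mulr0 subrr.
- apply: continuous_subspaceT => x; apply: continuous_comp; last exact: continuous_cos.
  exact: mulrl_continuous.
- split => //.
  + apply: cvg_at_right_filter; exact: cF.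
  + apply: cvg_at_left_filter; exact: cF.
- by move=> x _; rewrite derive1E; case: (dF x).
Qed.

(** The antiderivative is even, so it takes equal values at -1 and 1; it involves [m^-1], whence the
    separate case [m = 0]. *)
Lemma Rintegral_sin (m : R) : \int[mu]_(x in I) sin (m * x) = 0.
Proof.
have [->|m0] := eqVneq m 0.
  by under eq_Rintegral do rewrite mul0r sin0; rewrite Rintegral_cst// mul0r.
have dF (x : R) : is_derive x (1 : R) (fun x : R => - m^-1 * cos (m * x)) (sin (m * x)).
  by apply: is_derive_eq; rewrite /GRing.scale/=; field.
have cF : continuous (fun x : R => - m^-1 * cos (m * x)).
  by move=> x; apply/differentiable_continuous/derivable1_diffP; case: (dF x).
rewrite /Rintegral (@continuous_FTC2 _ _ (fun x => - m^-1 * cos (m * x)))//=.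
- by rewrite mulrN mulr1 cosN subrr.
- apply: continuous_subspaceT => x; apply: continuous_comp; last exact: continuous_sin.
  exact: mulrl_continuous.
- split => //.
  + apply: cvg_at_right_filter; exact: cF.
  + apply: cvg_at_left_filter; exact: cF.
- by move=> x _; rewrite derive1E; case: (dF x).
Qed.

End line.

(** * Bessel's inequality *)

(** A class closed under sums, products and bounded phases, and integrable on any measurable set of
    finite measure: integrability side conditions reduce to closure lemmas. *)
Definition bmeas {d} {T : measurableType d} {R : realType} (f : T -> R) : Prop :=
  measurable_fun setT f /\ exists M : R, forall x, `|f x| <= M.

Section bounded_measurable.
Context {d} {T : measurableType d} {R : realType}.
Implicit Types f g : T -> R.

Lemma bmeas_cst (r : R) : bmeas (fun _ : T => r).
Proof. by split; [exact: measurable_cst | exists `|r|]. Qed.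

Lemma bmeasD f g : bmeas f -> bmeas g -> bmeas (fun x => f x + g x).
Proof.
move=> [mf [M fM]] [mg [N gN]]; split; first exact: measurable_funD.
by exists (M + N) => x; apply: le_trans (ler_normD _ _) _; exact: lerD.
Qed.

Lemma bmeasM f g : bmeas f -> bmeas g -> bmeas (fun x => f x * g x).
Proof.
move=> [mf [M fM]] [mg [N gN]]; split; first exact: measurable_funM.
by exists (M * N) => x; rewrite normrM; exact: ler_pM.
Qed.

Lemma bmeasN f : bmeas f -> bmeas (fun x => - f x).
Proof.
move=> [mf [M fM]]; split; first exact: measurable_funN.
by exists M => x; rewrite normrN.
Qed.

Lemma bmeas_sum (I : Type) (s : seq I) (f : I -> T -> R) :
  (forall i, bmeas (f i)) -> bmeas (fun x => \sum_(i <- s) f i x).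
Proof.
move=> bf; elim: s => [|i s IH].
  by under eq_fun do rewrite big_nil; exact: bmeas_cst.
by under eq_fun do rewrite big_cons; exact: bmeasD.
Qed.

Lemma bmeas_cos f : measurable_fun setT f -> bmeas (fun x => cos (f x)).
Proof.
move=> mf; split.
  exact: (measurableT_comp (continuous_measurable_fun (@continuous_cos R)) mf).
by exists 1 => x; exact: cos_max.
Qed.

Lemma bmeas_sin f : measurable_fun setT f -> bmeas (fun x => sin (f x)).
Proof.
move=> mf; split.
  exact: (measurableT_comp (continuous_measurable_fun (@continuous_sin R)) mf).
by exists 1 => x; exact: sin_max.
Qed.

Lemma bmeas_integrable (mu : {measure set T -> \bar R}) (D : set T) f :
  measurable D -> (mu D < +oo)%E -> bmeas f -> mu.-integrable D (EFin \o f).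
Proof.
move=> mD muD [mf [M fM]]; apply: (@bounded_integrable _ _ _ _ _ _ M) => //.
exact: measurable_funTS.
Qed.

End bounded_measurable.

Section bessel.
Context {R : realType}.
Notation mu := (@lebesgue_measure R).
Notation I := (`[(-1 : R), 1]%classic).

Lemma bmeas_integrable_itv (f : measurableTypeR R -> R) : bmeas f -> mu.-integrable I
  (EFin \o f).
Proof.
move=> bf; apply: bmeas_integrable => //.
by rewrite [X in (X < _)%E](@lebesgue_measure_itvN11 R) ltry.
Qed.

Variables (f : measurableTypeR R -> R) (b : R).
Hypothesis bf : bmeas f.

(** Real and imaginary parts of the exponential of frequency b + pi k. On [-1, 1] these exponentials
    are orthogonal, with squared norm 2, for any offset [b]. *)
Let c (k : nat) (x : measurableTypeR R) : R := cos ((b + pi * k%:R) * x).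
Let s (k : nat) (x : measurableTypeR R) : R := sin ((b + pi * k%:R) * x).
Let C k := \int[mu]_(x in I) (c k x * f x).
Let S k := \int[mu]_(x in I) (s k x * f x).

Let mlin (a : R) : measurable_fun setT (fun x : measurableTypeR R => a * x).
Proof. exact: measurable_funM. Qed.

Let bc k : bmeas (c k). Proof. by apply: bmeas_cos; exact: mlin. Qed.
Let bs k : bmeas (s k). Proof. by apply: bmeas_sin; exact: mlin. Qed.

Let orth (k l : nat) (A B : R) :
  \int[mu]_(x in I) (A * cos ((pi * (k%:R - l%:R)) * x)
    + B * sin ((pi * (k%:R - l%:R)) * x)) = (k == l)%:R * (2 * A).
Proof.
have bcos a : bmeas (fun x : measurableTypeR R => cos (a * x)) by apply: bmeas_cos;
  exact: mlin.
have bsin a : bmeas (fun x : measurableTypeR R => sin (a * x)) by apply: bmeas_sin;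
  exact: mlin.
rewrite RintegralD//; try (apply: bmeas_integrable_itv; apply: bmeasM => //;
  exact: bmeas_cst).
rewrite !RintegralZl//; try exact: bmeas_integrable_itv.
rewrite Rintegral_sin mulr0 addr0.
have [->|kl] := eqVneq k l.
  under eq_Rintegral do rewrite subrr mulr0 mul0r cos0.
  by rewrite Rintegral_cst// [X in fine X](@lebesgue_measure_itvN11 R)/=; ring.
rewrite Rintegral_cos ?mulr0 ?mul0r//.
  by apply: mulf_neq0; [exact: lt0r_neq0 (pi_gt0 R)|rewrite subr_eq0 eqr_nat].
(* The sine is odd, so the difference of indices may be taken natural, and induction gives sin (n
   pi) = 0. *)
wlog lekl : k l {kl} / (l <= k)%N => [H|].
  case: (leqP l k) => [|/ltnW] lekl; first exact: H.
  by rewrite -opprB mulrN sinN H// oppr0.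
rewrite -natrB// mulrC; elim: (k - l)%N => [|n IH]; first by rewrite mul0r sin0.
by rewrite -natr1 mulrDl mul1r sinDpi IH oppr0.
Qed.

(** Expanding the integral of |f - (P + iQ)/2|^2 >= 0 gives the integral of f^2, minus T, plus T/2.
    The factor 1/2 is the inverse of the squared norm 2 of the exponentials. *)
Lemma bessel (N : nat) :
  \sum_(k < N) (C k ^+ 2 + S k ^+ 2) <= 2 * \int[mu]_(x in I) (f x ^+ 2).
Proof.
pose T : R := \sum_(k < N) (C k ^+ 2 + S k ^+ 2).
(* P + iQ is the sum of (C_k - i S_k) e^(i (b + pi k) x), twice the orthogonal projection of [f]. *)
pose P x := \sum_(k < N) (C k * c k x + S k * s k x).
pose Q x := \sum_(k < N) (C k * s k x - S k * c k x).
have bP1 (k : 'I_N) : bmeas (fun x => C k * c k x + S k * s k x).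
  by apply: bmeasD; apply: bmeasM => //; exact: bmeas_cst.
have bQ1 (k : 'I_N) : bmeas (fun x => C k * s k x - S k * c k x).
  by apply: bmeasD; [|apply: bmeasN]; apply: bmeasM => //; exact: bmeas_cst.
have bP : bmeas P by exact: bmeas_sum.
have bQ : bmeas Q by exact: bmeas_sum.
have fPE : \int[mu]_(x in I) (f x * P x) = T.
  under eq_Rintegral do rewrite mulr_sumr.
  rewrite Rintegral_sum//; last by move=> k; apply: bmeas_integrable_itv; exact: bmeasM.
  apply: eq_bigr => k _.
  under eq_Rintegral do rewrite mulrDr (mulrCA _ (C k)) (mulrCA _ (S k)) ![f _ *
    _]mulrC.
  rewrite RintegralD//; try by apply: bmeas_integrable_itv;
    repeat apply: bmeasM => //; exact: bmeas_cst.
  by rewrite !RintegralZl// ?expr2//; apply: bmeas_integrable_itv; exact: bmeasM.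
have PQE : \int[mu]_(x in I) (P x ^+ 2 + Q x ^+ 2) = 2 * T.
  (* The (k, l) term of |P + iQ|^2, where [b] drops out by the subtraction formulas; integration
     keeps the diagonal only. *)
  pose h (k l : 'I_N) x := (C k * C l + S k * S l) * cos ((pi * (k%:R - l%:R)) * x)
    + (S k * C l - C k * S l) * sin ((pi * (k%:R - l%:R)) * x).
  have bh k l : bmeas (h k l).
    by apply: bmeasD; apply: bmeasM; try exact: bmeas_cst;
      [by apply: bmeas_cos; exact: mlin | by apply: bmeas_sin; exact: mlin].
  transitivity (\int[mu]_(x in I) (\sum_(k < N) \sum_(l < N) h k l x)).
    apply: eq_Rintegral => x _.
    rewrite !expr2 /P /Q !mulr_suml -big_split/=; apply: eq_bigr => k _.
    rewrite !mulr_sumr -big_split/=; apply: eq_bigr => l _.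
    rewrite /h (_ : pi * _ * x = (b + pi * k%:R) * x - (b + pi * l%:R) * x);
      last by ring.
    by rewrite cosB sinB /c /s; ring.
  rewrite Rintegral_sum//; last first.
    by move=> k; apply: bmeas_integrable_itv; apply: bmeas_sum => l; exact: bh.
  rewrite mulr_sumr; apply: eq_bigr => k _.
  rewrite Rintegral_sum//; last by move=> l; apply: bmeas_integrable_itv; exact: bh.
  under eq_bigr do rewrite orth.
  rewrite (bigD1 k)//= eqxx mul1r big1 ?addr0 => [|l lk]; first by rewrite !expr2.
  by rewrite eq_sym val_eqE (negbTE lk) mul0r.
have bff : bmeas (fun x => f x ^+ 2) by under eq_fun do rewrite expr2; exact: bmeasM.
have bPP : bmeas (fun x => P x ^+ 2 + Q x ^+ 2).
  by under eq_fun do rewrite !expr2; apply: bmeasD; exact: bmeasM.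
have : 0 <= \int[mu]_(x in I) ((f x ^+ 2 - f x * P x) + 4^-1 * (P x ^+ 2 + Q x ^+ 2)).
  apply: Rintegral_ge0 => x _.
  rewrite (_ : _ + _ = (f x - P x / 2) ^+ 2 + (Q x / 2) ^+ 2); last by field.
  by rewrite addr_ge0// sqr_ge0.
rewrite RintegralD//; first last.
- by apply: bmeas_integrable_itv; apply: bmeasM => //; exact: bmeas_cst.
- by apply: bmeas_integrable_itv; apply: bmeasD => //; apply: bmeasN; exact: bmeasM.
rewrite RintegralB//; [|exact: bmeas_integrable_itv|by apply: bmeas_integrable_itv;
  exact: bmeasM].
rewrite RintegralZl//; last exact: bmeas_integrable_itv.
by rewrite fPE PQE -/T; lra.
Qed.

End bessel.

(** * Square integrability of transforms on the line *)

(** Tonelli's measurability result is for nonnegative integrands, so it is applied to the positive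
    and negative parts separately; [fine] then preserves measurability, default values included. *)
Lemma measurable_Rintegral {d1 d2} {T1 : measurableType d1} {T2 : measurableType d2}
    {R : realType} (nu : {sigma_finite_measure set T2 -> \bar R}) (h : T1 * T2 -> R) :
  measurable_fun setT h ->
  measurable_fun setT (fun x => \int[nu]_y h (x, y)).
Proof.
move=> mh; apply: measurableT_comp => //.
under eq_fun do rewrite integralE.
have mEh : measurable_fun setT (EFin \o h) by exact/measurable_EFinP.
apply: emeasurable_funB.
  have := @measurable_fun_fubini_tonelli_F _ _ T1 T2 R nu _ (measurable_funepos mEh).
  rewrite /fubini_F funepos.unlock; apply => x.
  by rewrite le_max lexx orbT.
have := @measurable_fun_fubini_tonelli_F _ _ T1 T2 R nu _ (measurable_funeneg mEh).
rewrite /fubini_F funeneg.unlock; apply => x.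
by rewrite le_max lexx orbT.
Qed.

Section tiling.
Context {R : realType}.
Notation mu := (@lebesgue_measure R).
Variables (G : measurableTypeR R -> \bar R).
Hypothesis mG : measurable_fun setT G.
Hypothesis G0 : forall x, (0 <= G x)%E.

Let msh (a : R) : measurable_fun setT (fun x : measurableTypeR R => G (x + a)%R).
Proof. by apply: measurableT_comp => //; exact: measurable_funD. Qed.

(** The last of the [N] tiles is translated back to the first one at each step of the induction. *)
Lemma integral_tile (a h : R) (N : nat) : 0 <= h ->
  (\int[mu]_(x in `[a, (a + N%:R * h)%R[) G x =
   \int[mu]_(x in `[a, (a + h)%R[) (\sum_(k < N) G (x + k%:R * h)%R))%E.
Proof.
move=> h0.
rewrite ge0_integral_sum//; last by move=> k; exact: measurable_funTS.
elim: N => [|N IH].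
  by rewrite mul0r addr0 set_itvco0 integral_set0 big_ord0.
rewrite big_ord_recr/= -IH.
have n0 : 0 <= N%:R * h by rewrite mulr_ge0.
rewrite (@itv_bndbnd_setU _ _ _ (BLeft (a + N%:R * h))); first last.
- by rewrite bnd_simp -[N.+1%:R]natr1; lra.
- by rewrite bnd_simp; lra.
rewrite ge0_integral_setU//=; first last.
- apply/disj_set2P; apply/seteqP; split => // x [] /=; rewrite !in_itv/=.
  by move=> /andP[_ h1] /andP[h2 _]; move: (lt_le_trans h1 h2); rewrite ltxx.
- exact: measurable_funTS.
congr (_ + _)%E.
rewrite (ge0_integral_shift (N%:R * h))//; last exact: measurable_funTS.
congr (integral mu _ _); apply/seteqP; split => x /=;
  rewrite !in_itv/= -[N.+1%:R]natr1; lra.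
Qed.

(** Any run of tiles of length 1/2 folds onto a single tile, on which the summed integrand is at
    most [K]; this gives K/2 on intervals that exhaust the line. *)
Lemma tiling_bound (K : R) :
  (forall (a : R) (N : nat), (\sum_(k < N) G (a + k%:R / 2)%R <= K%:E)%E) ->
  (\int[mu]_x G x <= (K / 2)%:E)%E.
Proof.
move=> GK.
have K0 : 0 <= K by have := GK 0 0; rewrite big_ord0 lee_fin.
have bnd a N : (\int[mu]_(x in `[a, (a + N%:R / 2)%R[) G x <= (K / 2)%:E)%E.
  rewrite integral_tile ?invr_ge0//.
  apply: (@le_trans _ _ (\int[mu]_(x in `[a, (a + 2^-1)%R[) (cst K%:E x))%E).
    apply: ge0_le_integral => //.
    - by move=> x _; exact: sume_ge0.
    - by apply: emeasurable_sum => k; exact: measurable_funTS.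
  rewrite integral_cst//= lebesgue_measure_itv/= lte_fin ifT; last lra.
  by rewrite -EFinB -EFinM lee_fin; nra.
pose F (i : nat) : set (measurableTypeR R) := [set` `[(- i%:R : R), i%:R[].
have cv : (\int[mu]_(x in F i) G x @[i --> \oo] --> \int[mu]_(x in \bigcup_i F i) G
  x)%E.
  apply: ge0_nondecreasing_set_cvg_integral => //.
  - apply/nondecreasing_seqP => n; apply/subsetPset => x; rewrite /F/= !in_itv/=.
    by rewrite -natr1; lra.
  - by move=> i; rewrite /F.
  - by move=> i; exact: measurable_funTS.
rewrite /F (bigcup_itvT true true) in cv.
rewrite -(cvg_lim _ cv)//; apply: lime_le; first by apply: cvgP cv.
apply: nearW => n.
(* The interval [-n, n[ consists of 4n tiles of length 1/2. *)
have := bnd (- n%:R) (4 * n)%N; rewrite natrM (_ : - _ + _ = n%:R)//.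
by field.
Qed.

End tiling.

Section plancherel_line.
Context {R : realType}.
Notation mu := (@lebesgue_measure R).
Notation I := (`[(-1 : R), 1]%classic).

Lemma Rintegral_supp_itv (h : measurableTypeR R -> R) :
  (forall x, 1 < `|x| -> h x = 0) -> \int[mu]_x h x = \int[mu]_(x in I) h x.
Proof.
move=> h0; rewrite [RHS]Rintegral_mkcond; congr Rintegral; apply/funext => x.
rewrite patchE; case: ifPn => // /negP; rewrite inE/= in_itv/= -ler_norml => /negP.
by rewrite -ltNge => /h0.
Qed.

(** At xi = a + k/2 the phase is (2 pi a + pi k) x, which is Bessel's frequency with offset 2 pi
    a. *)
Lemma plancherel_line (f : measurableTypeR R -> R) :
  bmeas f -> (forall x, 1 < `|x| -> f x = 0) ->
  (\int[mu]_xi ((\int[mu]_x (cos (2 * pi * (x * xi)) * f x)) ^+ 2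
              + (\int[mu]_x (sin (2 * pi * (x * xi)) * f x)) ^+ 2)%R%:E
   <= \int[mu]_x (f x ^+ 2)%R%:E)%E.
Proof.
move=> bf f0.
have [mf _] := bf.
have bff : bmeas (fun x => f x ^+ 2) by under eq_fun do rewrite expr2; exact: bmeasM.
have mph : measurable_fun setT
    (fun z : measurableTypeR R * measurableTypeR R => 2 * pi * (z.2 * z.1)).
  by apply: measurable_funM => //; apply: measurable_funM.
have mfz : measurable_fun setT (fun z : measurableTypeR R * measurableTypeR R => f z.2).
  exact: measurableT_comp.
pose G (xi : measurableTypeR R) := ((\int[mu]_x (cos (2 * pi * (x * xi)) * f x)) ^+ 2
              + (\int[mu]_x (sin (2 * pi * (x * xi)) * f x)) ^+ 2)%:E.
have -> : (\int[mu]_x (f x ^+ 2)%R%:E = (\int[mu]_(x in I) (f x ^+ 2))%R%:E)%E.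
  rewrite -Rintegral_supp_itv; last by move=> x /f0 ->; rewrite expr0n.
  rewrite fineK//; apply: integrable_fin_num => //.
  rewrite (_ : (fun x => _) = (EFin \o (fun x => f x ^+ 2)) \_ I).
    by rewrite -integrable_mkcond//; exact: bmeas_integrable_itv.
  apply/funext => x; rewrite patchE; case: ifPn => // /negP.
  by rewrite inE/= in_itv/= -ler_norml => /negP; rewrite -ltNge => /f0 /= ->;
    rewrite expr0n.
(* The factor 2 of Bessel's inequality is compensated exactly by the tile length 1/2. *)
have -> : (\int[mu]_(x in I) (f x ^+ 2)) = (2 * \int[mu]_(x in I) (f x ^+ 2)) / 2 by
  field.
apply: (@tiling_bound _ G).
- apply/measurable_EFinP; apply: measurable_funD; apply: measurable_funX.
  + apply: (@measurable_Rintegral _ _ _ _ _ mu (fun z : measurableTypeR R *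
      measurableTypeR R => cos (2 * pi * (z.2 * z.1)) * f z.2)).
    by apply: measurable_funM => //;
      exact: (measurableT_comp (continuous_measurable_fun (@continuous_cos R)) mph).
  + apply: (@measurable_Rintegral _ _ _ _ _ mu (fun z : measurableTypeR R *
      measurableTypeR R => sin (2 * pi * (z.2 * z.1)) * f z.2)).
    by apply: measurable_funM => //;
      exact: (measurableT_comp (continuous_measurable_fun (@continuous_sin R)) mph).
- by move=> x; rewrite lee_fin addr_ge0// sqr_ge0.
move=> a N; rewrite sumEFin lee_fin.
apply: le_trans (@bessel R f (2 * pi * a) bf N).
rewrite le_eqVlt; apply/orP; left; apply/eqP; apply: eq_bigr => k _.
have E x : 2 * pi * (x * (a + k%:R / 2)) = (2 * pi * a + pi * k%:R) * x by field.
rewrite !Rintegral_supp_itv; try by move=> x /f0 ->; rewrite mulr0.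
by under eq_Rintegral do rewrite E; under [X in _ + X ^+ 2]eq_Rintegral do rewrite E.
Qed.

End plancherel_line.

(** * Fubini's theorem for the tuple model of R^d *)

Section Rd_integrals.
Context {R : realType}.
Notation mu := (@lebesgue_measure R).

Lemma ge0_integral_RdS d (h : Rd R d.+1 -> \bar R) :
  measurable_fun setT h -> (forall x, (0 <= h x)%E) ->
  (\int[lebesgue_Rd d.+1]_x h x =
   \int[mu]_t \int[lebesgue_Rd d]_y h (consRd (t, y)))%E.
Proof.
move=> mh h0.
rewrite [LHS](@ge0_integral_pushforward _ _ _ _ _ _ (@measurable_consRd R d))//.
rewrite preimage_setT fubini_tonelli1//.
  by apply: measurableT_comp => //; exact: measurable_consRd.
by move=> x; exact: h0.
Qed.

Lemma ge0_integral_RdS_sym d (h : Rd R d.+1 -> \bar R) :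
  measurable_fun setT h -> (forall x, (0 <= h x)%E) ->
  (\int[lebesgue_Rd d.+1]_x h x =
   \int[lebesgue_Rd d]_y \int[mu]_t h (consRd (t, y)))%E.
Proof.
move=> mh h0; rewrite ge0_integral_RdS//.
rewrite (@fubini_tonelli _ _ _ _ R mu (lebesgue_Rd d) (h \o @consRd R d))//;
  last by move=> x; exact: h0.
by apply: measurableT_comp => //; exact: measurable_consRd.
Qed.

(** Unlike the ball, the cube is a product in the tuple model, so slicing preserves support in a
    cube. *)
Definition cube (r : R) d : set (Rd R d) :=
  [set x | forall i, `|tnth x i : R| <= r].

Lemma preimage_cubeS r d :
  @consRd R d @^-1` cube r d.+1 = `[- r, r]%classic `*` cube r d.
Proof.
apply/seteqP; split => -[t y] /=.
  move=> H; split.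
    by move: (H ord0); rewrite /consRd/= tnth0 in_itv/= -ler_norml.
  by move=> i; move: (H (lift ord0 i)); rewrite /consRd/= tnthS.
rewrite in_itv/= -ler_norml => -[ht hy] i.
by case: (unliftP ord0 i) => [j|] ->; rewrite /consRd/= ?tnthS ?tnth0.
Qed.

Lemma measurable_cube r d : measurable (cube r d).
Proof.
have -> : cube r d = \bigcap_(i in [set: 'I_d]) [set x : Rd R d | `|tnth x i : R| <= r].
  by apply/seteqP; split => x /= H i; [move=> _|]; apply: H.
apply: fin_bigcap_measurable => // i _.
rewrite [X in measurable X](_ : _ = (fun x : Rd R d => tnth x i) @^-1` `[- r, r]).
  by rewrite -[X in measurable X]setTI; apply: measurable_tnth.
by apply/seteqP; split => x /=; rewrite in_itv/= -ler_norml.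
Qed.

Lemma lebesgue_Rd_cube r d : 0 <= r ->
  (lebesgue_Rd d (cube r d) = ((2 * r) ^+ d)%:E)%E.
Proof.
move=> r0; elim: d => [|d IH].
  by rewrite /= diracE mem_set// => -[].
rewrite [LHS](_ : _ = (mu \x lebesgue_Rd d)%E (@consRd R d @^-1` cube r d.+1))//.
rewrite preimage_cubeS product_measure1E//; last exact: measurable_cube.
by rewrite [X in (X * _)%E](lebesgue_measure_itvNcc r)// [X in (_ * X)%E]IH -EFinM
  exprS.
Qed.

Lemma lebesgue_Rd_cube1 d : (lebesgue_Rd d (cube 1 d) = (2 ^+ d)%:E)%E.
Proof. by rewrite lebesgue_Rd_cube// mulr1. Qed.

Lemma bmeas_supp_integrable {dd} {T : measurableType dd} (nu : {measure set T -> \bar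
  R})
    (D : set T) (f : T -> R) :
  measurable D -> (nu D < +oo)%E -> bmeas f -> (forall x, ~ D x -> f x = 0) ->
  nu.-integrable setT (EFin \o f).
Proof.
move=> mD nuD bf f0.
rewrite (_ : EFin \o f = (EFin \o f) \_ D).
  by rewrite -integrable_mkcond//; exact: bmeas_integrable.
apply/funext => x; rewrite patchE; case: ifPn => // /negP.
by rewrite inE/= => /f0 ->.
Qed.

(** The class on which the induction on the dimension runs: it is stable under multiplication by
    bounded phases and under the partial transform in the first variable. *)
Definition cubic d (f : Rd R d -> R) :=
  bmeas f /\ forall x, ~ cube 1 d x -> f x = 0.

Lemma cubic_integrable d (f : Rd R d -> R) : cubic d f ->
  (lebesgue_Rd d).-integrable setT (EFin \o f).
Proof.
move=> [bf f0]; apply: (bmeas_supp_integrable _ (cube 1 d)) => //.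
  exact: measurable_cube.
by rewrite [X in (X < _)%E](lebesgue_Rd_cube1 d) ltry.
Qed.

Lemma cubicM d (g f : Rd R d -> R) : bmeas g -> cubic d f -> cubic d (fun x => g x *
  f x).
Proof.
move=> bg [bf f0]; split; first exact: bmeasM.
by move=> x /f0 ->; rewrite mulr0.
Qed.

Lemma cubic_slice d (f : Rd R d.+1 -> R) y : cubic d.+1 f ->
  bmeas (fun t : measurableTypeR R => f (consRd (t, y))) /\
  forall t, 1 < `|t| -> f (consRd (t, y)) = 0.
Proof.
move=> [[mf [M fM]] f0]; split.
  split; last by exists M => t; exact: fM.
  apply: measurableT_comp => //.
  exact: (measurableT_comp (@measurable_consRd R d) (@pair2_measurable _ _ _ _ y)).
move=> t t1; apply: f0 => /(_ ord0); rewrite /consRd/= tnth0 leNgt.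
by rewrite t1.
Qed.

Lemma slice_integrable (f : measurableTypeR R -> R) :
  bmeas f -> (forall t, 1 < `|t| -> f t = 0) -> mu.-integrable setT (EFin \o f).
Proof.
move=> bf f0; apply: (@bmeas_supp_integrable _ _ mu `[(-1 : R), 1]%classic) => //.
  by rewrite [X in (X < _)%E](@lebesgue_measure_itvN11 R) ltry.
move=> t /=; rewrite in_itv/= -ler_norml => /negP; rewrite -ltNge.
exact: f0.
Qed.

(** Fubini for a bounded function supported in a set of finite measure. The first coordinate is
    innermost, so that the inner integral becomes a partial transform. *)
Lemma Rintegral_RdS d (f : Rd R d.+1 -> R) : cubic d.+1 f ->
  \int[lebesgue_Rd d.+1]_x f x =
  \int[lebesgue_Rd d]_y \int[mu]_t f (consRd (t, y)).
Proof.
move=> cf; have [[mf [M fM]] f0] := cf.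
have mcf : measurable_fun setT (f \o @consRd R d).
  by apply: measurableT_comp => //; exact: measurable_consRd.
have icf : (mu \x lebesgue_Rd d)%E.-integrable setT ((EFin \o f) \o @consRd R d).
  apply: (bmeas_supp_integrable _ (@consRd R d @^-1` cube 1 d.+1) (f \o @consRd R d)).
  - rewrite preimage_cubeS; apply: measurableX => //; exact: measurable_cube.
  - rewrite preimage_cubeS [X in (X < _)%E](product_measure1E mu (lebesgue_Rd d))//;
      last exact: measurable_cube.
    by rewrite [X in (X * _)%E](@lebesgue_measure_itvN11 R) [X in (_ *
      X)%E](lebesgue_Rd_cube1 d) -EFinM ltry.
  - by split=> //; exists M => x; exact: fM.
  - by move=> x; exact: f0.
rewrite /Rintegral; congr fine.
rewrite [LHS](@integral_pushforward _ _ _ _ _ _ (@measurable_consRd R d))//; last first.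
  exact/measurable_EFinP.
rewrite preimage_setT -integral21_prod_meas1//.
apply: eq_integral => y _.
(* Each slice is integrable, so its real-valued integral agrees with the extended one. *)
rewrite /fubini_G fineK//.
have [b0 s0] := cubic_slice d f y cf.
exact: integrable_fin_num (slice_integrable _ b0 s0).
Qed.

End Rd_integrals.

(** * Cosine and sine transforms on R^d *)

Section transforms.
Context {R : realType}.
Notation mu := (@lebesgue_measure R).

(** For real [f] the Fourier transform is [cosT] - i [sinT]; keeping the two apart allows real
    integrals throughout. *)
Definition cosT d (f : Rd R d -> R) (xi : Rd R d) : R :=
  \int[lebesgue_Rd d]_x (cos (2 * pi * dotp x xi) * f x).

Definition sinT d (f : Rd R d -> R) (xi : Rd R d) : R :=
  \int[lebesgue_Rd d]_x (sin (2 * pi * dotp x xi) * f x).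

Lemma dotp_consRd d (t s : R) (x y : Rd R d) :
  dotp (consRd (t, x)) (consRd (s, y)) = t * s + dotp x y.
Proof.
rewrite /dotp big_ord_recl /consRd/= !tnth0; congr (_ + _).
by apply: eq_bigr => i _; rewrite !tnthS.
Qed.

Lemma measurable_dotp {dd} {T : measurableType dd} d (f g : T -> Rd R d) :
  measurable_fun setT f -> measurable_fun setT g ->
  measurable_fun setT (fun x => dotp (f x) (g x)).
Proof.
move=> /measurable_fun_tnthP mf /measurable_fun_tnthP mg.
by apply: measurable_sum => i; apply: measurable_funM; [exact: mf|exact: mg].
Qed.

Lemma measurable_phase {dd} {T : measurableType dd} d (f g : T -> Rd R d) :
  measurable_fun setT f -> measurable_fun setT g ->
  measurable_fun setT (fun x => 2 * pi * dotp (f x) (g x)).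
Proof. by move=> mf mg; apply: measurable_funM => //; exact: measurable_dotp. Qed.

Lemma bmeas_cos_phase d (xi : Rd R d) : bmeas (fun x : Rd R d => cos (2 * pi * dotp x
  xi)).
Proof. by apply: bmeas_cos; exact: measurable_phase. Qed.

Lemma bmeas_sin_phase d (xi : Rd R d) : bmeas (fun x : Rd R d => sin (2 * pi * dotp x
  xi)).
Proof. by apply: bmeas_sin; exact: measurable_phase. Qed.

Lemma measurable_cosT d (f : Rd R d -> R) :
  measurable_fun setT f -> measurable_fun setT (cosT d f).
Proof.
move=> mf; apply: (@measurable_Rintegral _ _ _ _ _ (lebesgue_Rd d)
  (fun z : Rd R d * Rd R d => cos (2 * pi * dotp z.2 z.1) * f z.2)).
apply: measurable_funM; last exact: measurableT_comp.
apply: (measurableT_comp (continuous_measurable_fun (@continuous_cos R))).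
exact: measurable_phase.
Qed.

Lemma measurable_sinT d (f : Rd R d -> R) :
  measurable_fun setT f -> measurable_fun setT (sinT d f).
Proof.
move=> mf; apply: (@measurable_Rintegral _ _ _ _ _ (lebesgue_Rd d)
  (fun z : Rd R d * Rd R d => sin (2 * pi * dotp z.2 z.1) * f z.2)).
apply: measurable_funM; last exact: measurableT_comp.
apply: (measurableT_comp (continuous_measurable_fun (@continuous_sin R))).
exact: measurable_phase.
Qed.

(* The transform in the first variable alone; [k] is [cos] or [sin]. *)
Definition sliceT d (k : R -> R) (f : Rd R d.+1 -> R) (s : R) (y : Rd R d) : R :=
  \int[mu]_t (k (2 * pi * (t * s)) * f (consRd (t, y))).

Lemma measurable_sliceT {d} (k : R -> R) (f : Rd R d.+1 -> R) :
  measurable_fun setT k -> measurable_fun setT f ->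
  measurable_fun setT (fun z : measurableTypeR R * Rd R d => sliceT d k f z.1 z.2).
Proof.
move=> mk mf; apply: (@measurable_Rintegral _ _ _ _ _ mu
  (fun w : (measurableTypeR R * Rd R d) * measurableTypeR R =>
     k (2 * pi * (w.2 * w.1.1)) * f (consRd (w.2, w.1.2)))).
have m1 : measurable_fun setT
    (fun w : (measurableTypeR R * Rd R d) * measurableTypeR R => w.1.1).
  exact: measurableT_comp.
have m2 : measurable_fun setT
    (fun w : (measurableTypeR R * Rd R d) * measurableTypeR R => w.1.2).
  exact: measurableT_comp.
apply: measurable_funM.
  apply: measurableT_comp => //; apply: measurable_funM => //.
  exact: measurable_funM.
apply: measurableT_comp => //.
apply: (measurableT_comp (@measurable_consRd R d)).
exact: measurable_fun_pair.
Qed.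

(** The slice lives on [-1, 1], of length 2, so a bound [M] for [f] becomes [M * 2]. *)
Lemma cubic_sliceT d (k : R -> R) (f : Rd R d.+1 -> R) (s : R) :
  measurable_fun setT k -> (forall t, `|k t| <= 1) -> cubic d.+1 f ->
  cubic d (sliceT d k f s).
Proof.
move=> mk k1 cf; have [[mf [M fM]] f0] := cf.
have bk : bmeas (fun t : measurableTypeR R => k (2 * pi * (t * s))).
  split; last by exists 1 => t; exact: k1.
  apply: measurableT_comp => //; apply: measurable_funM => //; exact: measurable_funM.
have M0 : 0 <= M := le_trans (normr_ge0 _) (fM (consRd (0, [tuple 0 | i < d]))).
split; first split.
- exact: (measurableT_comp (measurable_sliceT k f mk mf) (@pair1_measurable _ _ _ _ s)).
- exists (M * 2) => y; have [b0 s0] := cubic_slice d f y cf.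
  rewrite /sliceT Rintegral_supp_itv; last by move=> t /s0 ->; rewrite mulr0.
  have bb := bmeasM _ _ bk b0.
  apply: le_trans (le_normr_Rintegral _ (bmeas_integrable_itv _ bb)) _ => //.
  have <- : \int[mu]_(t in `[(-1 : R), 1]) M = M * 2.
    by rewrite Rintegral_cst// [X in fine X](@lebesgue_measure_itvN11 R).
  apply: le_Rintegral => //.
  + by have := bmeas_integrable_itv _ bb; exact: integrable_norm.
  + exact/bmeas_integrable_itv/bmeas_cst.
  + by move=> t _; rewrite normrM -[leRHS]mul1r; apply: ler_pM.
(* If [y] lies outside the cube, so does every point obtained by putting a coordinate in front of
   it. *)
- move=> y yQ; have f0y t : f (consRd (t, y)) = 0.
    by apply: f0 => H; apply: yQ => i; have := H (lift ord0 i); rewrite /consRd/= tnthS.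
  rewrite /sliceT; under eq_Rintegral do rewrite f0y mulr0.
  by rewrite Rintegral_cst// mul0r.
Qed.

(** The phase splits as t s + y . eta; Fubini and the addition formula separate the two
    variables. *)
Lemma cosT_consRd d (f : Rd R d.+1 -> R) (s : R) (eta : Rd R d) : cubic d.+1 f ->
  cosT d.+1 f (consRd (s, eta)) =
  cosT d (sliceT d cos f s) eta - sinT d (sliceT d sin f s) eta.
Proof.
move=> cf.
have cc := cubic_sliceT d cos f s (continuous_measurable_fun (@continuous_cos R))
  (@cos_max R) cf.
have cs := cubic_sliceT d sin f s (continuous_measurable_fun (@continuous_sin R))
  (@sin_max R) cf.
rewrite /cosT Rintegral_RdS; last by apply: cubicM => //; exact: bmeas_cos_phase.
rewrite /sinT -RintegralB//; first last.
- by apply: cubic_integrable; apply: cubicM => //; exact: bmeas_sin_phase.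
- by apply: cubic_integrable; apply: cubicM => //; exact: bmeas_cos_phase.
apply: eq_Rintegral => y _; have [b0 s0] := cubic_slice d f y cf.
have mph : measurable_fun setT (fun t : measurableTypeR R => 2 * pi * (t * s)).
  by apply: measurable_funM => //; exact: measurable_funM.
have ic : mu.-integrable setT
    (EFin \o (fun t => cos (2 * pi * (t * s)) * f (consRd (t, y)))).
  apply: slice_integrable; first by apply: bmeasM => //; exact: bmeas_cos.
  by move=> t /s0 ->; rewrite mulr0.
have isn : mu.-integrable setT
    (EFin \o (fun t => sin (2 * pi * (t * s)) * f (consRd (t, y)))).
  apply: slice_integrable; first by apply: bmeasM => //; exact: bmeas_sin.
  by move=> t /s0 ->; rewrite mulr0.
rewrite /sliceT -!RintegralZl// -RintegralB//.
- apply: eq_Rintegral => t _; rewrite dotp_consRd mulrDr cosD; ring.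
- exact: (integrableZl _ _ ic).
- exact: (integrableZl _ _ isn).
Qed.

Lemma sinT_consRd d (f : Rd R d.+1 -> R) (s : R) (eta : Rd R d) : cubic d.+1 f ->
  sinT d.+1 f (consRd (s, eta)) =
  sinT d (sliceT d cos f s) eta + cosT d (sliceT d sin f s) eta.
Proof.
move=> cf.
have cc := cubic_sliceT d cos f s (continuous_measurable_fun (@continuous_cos R))
  (@cos_max R) cf.
have cs := cubic_sliceT d sin f s (continuous_measurable_fun (@continuous_sin R))
  (@sin_max R) cf.
rewrite {1}/sinT Rintegral_RdS; last by apply: cubicM => //; exact: bmeas_sin_phase.
rewrite /cosT /sinT -RintegralD//; first last.
- by apply: cubic_integrable; apply: cubicM => //; exact: bmeas_cos_phase.
- by apply: cubic_integrable; apply: cubicM => //; exact: bmeas_sin_phase.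
apply: eq_Rintegral => y _; have [b0 s0] := cubic_slice d f y cf.
have mph : measurable_fun setT (fun t : measurableTypeR R => 2 * pi * (t * s)).
  by apply: measurable_funM => //; exact: measurable_funM.
have ic : mu.-integrable setT
    (EFin \o (fun t => cos (2 * pi * (t * s)) * f (consRd (t, y)))).
  apply: slice_integrable; first by apply: bmeasM => //; exact: bmeas_cos.
  by move=> t /s0 ->; rewrite mulr0.
have isn : mu.-integrable setT
    (EFin \o (fun t => sin (2 * pi * (t * s)) * f (consRd (t, y)))).
  apply: slice_integrable; first by apply: bmeasM => //; exact: bmeas_sin.
  by move=> t /s0 ->; rewrite mulr0.
rewrite /sliceT -!RintegralZl// -RintegralD//.
- apply: eq_Rintegral => t _; rewrite dotp_consRd mulrDr sinD; ring.
- exact: (integrableZl _ _ ic).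
- exact: (integrableZl _ _ isn).
Qed.

End transforms.

(** * Square integrability of the transform on R^d *)

Section plancherel.
Context {R : realType}.
Notation mu := (@lebesgue_measure R).

Lemma measurable_cosT2_sinT2 d (f : Rd R d -> R) : measurable_fun setT f ->
  measurable_fun setT (fun xi => (cosT d f xi ^+ 2 + sinT d f xi ^+ 2)%:E).
Proof.
move=> mf; apply/measurable_EFinP; apply: measurable_funD; apply: measurable_funX.
- exact: measurable_cosT.
- exact: measurable_sinT.
Qed.

Lemma measurable_sliceT2 d (f : Rd R d.+1 -> R) : measurable_fun setT f ->
  measurable_fun setT (fun z : measurableTypeR R * Rd R d =>
    (sliceT d cos f z.1 z.2 ^+ 2 + sliceT d sin f z.1 z.2 ^+ 2)%:E).
Proof.
move=> mf; apply/measurable_EFinP; apply: measurable_funD; apply: measurable_funX.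
- exact: measurable_sliceT (continuous_measurable_fun (@continuous_cos R)) mf.
- exact: measurable_sliceT (continuous_measurable_fun (@continuous_sin R)) mf.
Qed.

(** The left side is the energy of the transform of the complex function a - i b. The parallelogram
    law bounds it by those of [a] and [b], at the cost of a factor 2. *)
Lemma plancherel_pair d (K : R) (a b : Rd R d -> R) : 0 <= K ->
  measurable_fun setT a -> measurable_fun setT b ->
  (\int[lebesgue_Rd d]_xi (cosT d a xi ^+ 2 + sinT d a xi ^+ 2)%:E
   <= K%:E * \int[lebesgue_Rd d]_x (a x ^+ 2)%:E)%E ->
  (\int[lebesgue_Rd d]_xi (cosT d b xi ^+ 2 + sinT d b xi ^+ 2)%:E
   <= K%:E * \int[lebesgue_Rd d]_x (b x ^+ 2)%:E)%E ->
  (\int[lebesgue_Rd d]_xi ((cosT d a xi - sinT d b xi) ^+ 2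
     + (sinT d a xi + cosT d b xi) ^+ 2)%:E
   <= (2 * K)%:E * \int[lebesgue_Rd d]_x (a x ^+ 2 + b x ^+ 2)%:E)%E.
Proof.
move=> K0 ma mb Ha Hb.
have mTa := measurable_cosT2_sinT2 d a ma.
have mTb := measurable_cosT2_sinT2 d b mb.
have T0 (g : Rd R d -> R) x : (0 <= (cosT d g x ^+ 2 + sinT d g x ^+ 2)%:E)%E.
  by rewrite lee_fin addr_ge0// sqr_ge0.
have S0 (g : Rd R d -> R) x : (0 <= (g x ^+ 2)%:E)%E by rewrite lee_fin sqr_ge0.
have mD := emeasurable_funD mTa mTb.
apply: (@le_trans _ _ (\int[lebesgue_Rd d]_xi (2%:E *
   ((cosT d a xi ^+ 2 + sinT d a xi ^+ 2)%:E +
    (cosT d b xi ^+ 2 + sinT d b xi ^+ 2)%:E)))%E).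
  apply: ge0_le_integral => //.
  - by move=> xi _; rewrite lee_fin addr_ge0// sqr_ge0.
  - apply/measurable_EFinP.
    have mca := measurable_cosT d a ma; have msa := measurable_sinT d a ma.
    have mcb := measurable_cosT d b mb; have msb := measurable_sinT d b mb.
    apply: measurable_funD; apply: measurable_funX.
      exact: measurable_funB.
    exact: measurable_funD.
  - exact: emeasurable_funM.
  - move=> xi _; rewrite -EFinD -EFinM lee_fin.
    set p := cosT _ a _; set q := sinT _ b _; set r := sinT _ a _.
    set t := cosT _ b _.
    rewrite -subr_ge0 (_ : _ - _ = (p + q) ^+ 2 + (r - t) ^+ 2); last by ring.
    by rewrite addr_ge0// sqr_ge0.
rewrite ge0_integralZl//; last by move=> x _; rewrite adde_ge0.
have -> : (\int[lebesgue_Rd d]_y (a y ^+ 2 + b y ^+ 2)%:E =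
    \int[lebesgue_Rd d]_y (a y ^+ 2)%:E + \int[lebesgue_Rd d]_y (b y ^+ 2)%:E)%E.
  under eq_integral do rewrite EFinD.
  by rewrite ge0_integralD//; apply/measurable_EFinP; exact: measurable_funX.
rewrite ge0_integralD// EFinM -muleA; apply: lee_wpmul2l => //.
by rewrite ge0_muleDr ?integral_ge0//; exact: leeD.
Qed.

(** For fixed first frequency [s] the induction hypothesis applies to the partial transforms; after
    exchanging the integrals, the line case applies for fixed [y]. Each dimension costs the factor 2
    of [plancherel_pair], harmless since only finiteness is wanted. *)
Lemma plancherel d (f : Rd R d -> R) : cubic d f ->
  (\int[lebesgue_Rd d]_xi (cosT d f xi ^+ 2 + sinT d f xi ^+ 2)%:E
   <= (2 ^+ d)%:E * \int[lebesgue_Rd d]_x (f x ^+ 2)%:E)%E.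
Proof.
elim: d f => [|d IH] f cf; have [[mf [M fM]] f0] := cf.
  (* On the one-point space R^0 the phase is 0: [cosT] is the value of [f] and [sinT] is 0. *)
  rewrite /= !integral_dirac//; last first.
  - exact: measurable_cosT2_sinT2.
  - by apply/measurable_EFinP; exact: measurable_funX.
  rewrite diracT !mul1e ?expr0 ?mul1e lee_fin /cosT /sinT /Rintegral /=
    !integral_dirac//.
  - rewrite diracT !mul1e/= /dotp !big_ord0 !mulr0 cos0 sin0 mul1r mul0r.
    by rewrite expr0n/= addr0.
  - apply/measurable_EFinP; apply: measurable_funM => //.
    by have [] := @bmeas_sin_phase R 0 [tuple].
  - apply/measurable_EFinP; apply: measurable_funM => //.
    by have [] := @bmeas_cos_phase R 0 [tuple].
pose a (s : measurableTypeR R) (y : Rd R d) := sliceT d cos f s y.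
pose b (s : measurableTypeR R) (y : Rd R d) := sliceT d sin f s y.
have ca s : cubic d (a s).
  exact: cubic_sliceT (continuous_measurable_fun (@continuous_cos R)) (@cos_max R) cf.
have cb s : cubic d (b s).
  exact: cubic_sliceT (continuous_measurable_fun (@continuous_sin R)) (@sin_max R) cf.
have m2 (s : measurableTypeR R) : measurable_fun setT
    (fun y => (a s y ^+ 2 + b s y ^+ 2)%:E).
  exact: (measurableT_comp (measurable_sliceT2 d f mf) (@pair1_measurable _ _ _ _ s)).
have step s : (\int[lebesgue_Rd d]_eta (cosT d.+1 f (consRd (s, eta)) ^+ 2
      + sinT d.+1 f (consRd (s, eta)) ^+ 2)%:E
    <= (2 ^+ d.+1)%:E * \int[lebesgue_Rd d]_y (a s y ^+ 2 + b s y ^+ 2)%:E)%E.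
  under eq_integral do rewrite cosT_consRd// sinT_consRd// -/(a s) -/(b s).
  have [[ma _] _] := ca s; have [[mb _] _] := cb s.
  rewrite exprS; apply: plancherel_pair => //; rewrite ?exprn_ge0//.
  + exact: IH (ca s).
  + exact: IH (cb s).
have i0 (s : measurableTypeR R) : (0 <= \int[lebesgue_Rd d]_y (a s y ^+ 2 + b s y ^+
  2)%:E)%E.
  by apply: integral_ge0 => x _; rewrite lee_fin addr_ge0// sqr_ge0.
have mi : measurable_fun setT
    (fun s : measurableTypeR R => (\int[lebesgue_Rd d]_y (a s y ^+ 2 + b s y ^+
      2)%:E)%E).
  have := @measurable_fun_fubini_tonelli_F _ _ _ _ R (lebesgue_Rd d) _
    (measurable_sliceT2 d f mf).
  by apply => z; rewrite lee_fin addr_ge0// sqr_ge0.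
rewrite ge0_integral_RdS; first last.
- by move=> x; rewrite lee_fin addr_ge0// sqr_ge0.
- exact: measurable_cosT2_sinT2.
apply: (@le_trans _ _ (\int[mu]_s ((2 ^+ d.+1)%:E *
    \int[lebesgue_Rd d]_y (a s y ^+ 2 + b s y ^+ 2)%:E))%E).
  apply: ge0_le_integral => //.
  - by move=> s _; apply: integral_ge0 => x _; rewrite lee_fin addr_ge0// sqr_ge0.
  - have mc : measurable_fun setT ((fun xi => (cosT d.+1 f xi ^+ 2 + sinT d.+1 f xi
      ^+ 2)%:E) \o @consRd R d).
      by apply: measurableT_comp;
        [exact: measurable_cosT2_sinT2|exact: measurable_consRd].
    have := @measurable_fun_fubini_tonelli_F _ _ _ _ R (lebesgue_Rd d) _ mc.
    by apply => z; rewrite lee_fin addr_ge0// sqr_ge0.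
  - exact: emeasurable_funM.
rewrite ge0_integralZl//.
apply: lee_wpmul2l; first by rewrite lee_fin exprn_ge0.
(* From here [y] is the outer variable on both sides, and the claim is the line case for each
   slice. *)
rewrite (@fubini_tonelli _ _ _ _ R mu (lebesgue_Rd d) _ (measurable_sliceT2 d f mf));
  last first.
  by move=> z; rewrite lee_fin addr_ge0// sqr_ge0.
have mf2 : measurable_fun setT (fun x => (f x ^+ 2)%:E).
  by apply/measurable_EFinP; exact: measurable_funX.
rewrite ge0_integral_RdS_sym//; last by move=> x; rewrite lee_fin sqr_ge0.
apply: ge0_le_integral => //.
- by move=> s _; apply: integral_ge0 => x _; rewrite lee_fin addr_ge0// sqr_ge0.
- have := @measurable_fun_fubini_tonelli_G _ _ _ _ R mu _ (measurable_sliceT2 d f mf).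
  by apply => z; rewrite lee_fin addr_ge0// sqr_ge0.
- have mc : measurable_fun setT ((fun x => (f x ^+ 2)%:E) \o @consRd R d).
    by apply: measurableT_comp => //; exact: measurable_consRd.
  have := @measurable_fun_fubini_tonelli_G _ _ _ _ R mu _ mc.
  by apply => z; rewrite lee_fin sqr_ge0.
- move=> y _; have [b0 s0] := cubic_slice d f y cf.
  exact: plancherel_line b0 s0.
Qed.

End plancherel.

(** * Lower bound for the infimum over affine functions *)

Section second_difference.
Context {R : realType}.
Notation mu := (@lebesgue_measure R).
Notation normc := ComplexField.Normc.normc.

Lemma normc_ge0 (z : R[i]) : 0 <= normc z.
Proof. by case: z => a b; exact: sqrtr_ge0. Qed.

Lemma normc_expi (t : R) : normc (expi t) = 1.
Proof. by rewrite /expi/= cos2Dsin2 sqrtr1. Qed.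

Lemma expiD (s t : R) : expi (s + t) = expi s * expi t.
Proof. by rewrite /expi cosD sinD; congr (_ +i* _)%C; rewrite addrC. Qed.

Definition chord (t : R) : R := normc (expi t - 1).

Lemma chordE (t : R) : chord t = Num.sqrt (2 * (1 - cos t)).
Proof.
rewrite /chord /expi/= subr0; congr Num.sqrt.
by rewrite sqrrB sin2cos2; ring.
Qed.

Lemma chordN (t : R) : chord (- t) = chord t.
Proof. by rewrite !chordE cosN. Qed.

(** From e^(i(s+t)) - 1 = e^(is) (e^(it) - 1) + (e^(is) - 1) and |e^(is)| = 1. *)
Lemma chordD (s t : R) : chord (s + t) <= chord s + chord t.
Proof.
rewrite /chord expiD (_ : _ - 1 = expi s * (expi t - 1) + (expi s - 1)).
  apply: le_trans (le_normcD _ _) _.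
  by rewrite ComplexField.Normc.normcM normc_expi mul1r addrC.
by rewrite mulrBr mulr1 addrA subrK.
Qed.

Lemma chord_ge0 t : 0 <= chord t. Proof. exact: normc_ge0. Qed.

Lemma measurable_chord {dd} {T : measurableType dd} (f : T -> R) :
  measurable_fun setT f -> measurable_fun setT (fun x => chord (f x)).
Proof.
move=> mf; under eq_fun do rewrite chordE.
apply: measurableT_comp; first exact: (continuous_measurable_fun (@sqrt_continuous R)).
apply: measurable_funM => //; apply: measurable_funB => //.
exact: (measurableT_comp (continuous_measurable_fun (@continuous_cos R)) mf).
Qed.

(** One of [u], [v], [w] is at least c/4: otherwise u + 2 v + w < c. *)
Lemma powR_quarter_le (p c u v w : R) : 0 <= p ->
  0 <= c -> 0 <= u -> 0 <= v -> 0 <= w -> c <= u + 2 * v + w ->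
  (c / 4) `^ p <= u `^ p + v `^ p + w `^ p.
Proof.
move=> p0 c0 u0 v0 w0 cE.
have up := powR_ge0 u p; have vp := powR_ge0 v p; have wp := powR_ge0 w p.
have key r : 0 <= r -> c / 4 <= r -> (c / 4) `^ p <= r `^ p.
  by move=> r0 h; apply: ge0_ler_powR => //; rewrite nnegrE divr_ge0.
have [h|hu] := leP (c / 4) u; first by have := key _ u0 h; lra.
have [h|hv] := leP (c / 4) v; first by have := key _ v0 h; lra.
have h : c / 4 <= w by lra.
by have := key _ w0 h; lra.
Qed.

Lemma chord_second_difference (p x y z : R) : 0 <= p ->
  (chord (x - 2 * y + z) / 4) `^ p <= chord x `^ p + chord y `^ p + chord z `^ p.
Proof.
move=> p0; apply: powR_quarter_le; rewrite ?chord_ge0//.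
apply: le_trans (chordD _ _) _; rewrite lerD2r.
apply: le_trans (chordD _ _) _.
rewrite lerD2l chordN mulr_natl mulr2n mulr_natl mulr2n.
exact: chordD.
Qed.

(** Along each line in the first direction, the integral over [0, 3h[ folds onto [0, h[, where the
    hypothesis bounds the sum of the three translates. *)
Lemma slab_lower_bound d (u : Rd R d.+1 -> \bar R) (h c : R) (A : set (Rd R d)) :
  measurable_fun setT u -> (forall x, (0 <= u x)%E) ->
  0 <= h -> 0 <= c -> measurable A ->
  (forall t y, 0 <= t < h -> A y ->
    (c%:E <= \sum_(k < 3) u (consRd ((t + k%:R * h)%R, y)))%E) ->
  ((c * h)%:E * lebesgue_Rd d A <= \int[lebesgue_Rd d.+1]_x u x)%E.
Proof.
move=> mu_ u0 h0 c0 mA H.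
rewrite ge0_integral_RdS_sym// -integral_cst//.
have mc : measurable_fun setT (u \o @consRd R d).
  by apply: measurableT_comp => //; exact: measurable_consRd.
have mG : measurable_fun setT (fun y => \int[mu]_t u (consRd (t, y)))%E.
  have := @measurable_fun_fubini_tonelli_G _ _ _ _ R mu _ mc.
  by apply => z; exact: u0.
apply: (@le_trans _ _ (\int[lebesgue_Rd d]_(y in A) \int[mu]_t u (consRd (t, y)))%E);
  last first.
  by apply: ge0_subset_integral => // y _; exact: integral_ge0.
apply: ge0_le_integral => //.
- by move=> y _ /=; rewrite lee_fin mulr_ge0.
- exact: measurable_funTS.
move=> y Ay.
have my : measurable_fun setT (fun t : measurableTypeR R => u (consRd (t, y))).
  exact: (measurableT_comp mc (@pair2_measurable _ _ _ _ y)).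
apply: (@le_trans _ _ (\int[mu]_(t in `[0%R, (0 + 3%:R * h)%R[) u (consRd (t,
  y)))%E); last first.
  exact: ge0_subset_integral.
rewrite (integral_tile (fun t => u (consRd (t, y))))//.
apply: (@le_trans _ _ (\int[mu]_(t in `[0%R, (0 + h)%R[) (cst c%:E t))%E).
  rewrite integral_cst//= lebesgue_measure_itv/= add0r lte_fin.
  by case: ltP => h1; rewrite ?sube0 -?EFinM ?mule0 lee_fin//; nra.
apply: ge0_le_integral => //.
- apply: emeasurable_sum => k.
  apply: measurable_funTS; apply: (measurableT_comp my).
  exact: measurable_funD.
- move=> t /=; rewrite in_itv/= add0r => ht.
  exact: H.
Qed.

End second_difference.

(** * The strip perturbation and its distance from the affine functions *)

Section strip.
Context {R : realType}.
Notation normc := ComplexField.Normc.normc.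

Lemma measurable_unit_ball d : measurable (@unit_ball R d).
Proof.
rewrite /unit_ball -[X in measurable X]setTI.
have m : measurable_fun setT (fun x : Rd R d => Num.sqrt (dotp x x)).
  apply: measurableT_comp;
    first exact: (continuous_measurable_fun (@sqrt_continuous R)).
  exact: measurable_dotp.
rewrite (_ : [set x | _] = (fun x : Rd R d => Num.sqrt (dotp x x)) @^-1` `]-oo, 1]).
  exact: m.
by apply/seteqP; split => x /=; rewrite in_itv.
Qed.

Lemma unit_ball_cube d : @unit_ball R d `<=` cube 1 d.
Proof.
move=> x /= xB i; rewrite -sqrtr_sqr.
apply: le_trans xB; rewrite ler_wsqrtr// /dotp (bigD1 i)//= expr2 lerDl.
by apply: sumr_ge0 => j _; exact: sqr_ge0.
Qed.

Definition strip d (h : R) : set (Rd R d.+1) := [set x | 0 <= (tnth x ord0 : R) < h].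

Lemma measurable_strip d h : measurable (strip d h).
Proof.
rewrite /strip -[X in measurable X]setTI.
rewrite (_ : [set x | _] = (fun x : Rd R d.+1 => tnth x ord0) @^-1` `[0, h[).
  exact: measurable_tnth.
by apply/seteqP; split => x /=; rewrite in_itv.
Qed.

Definition strip_fun d (h delta : R) (x : Rd R d.+1) : R := delta * \1_(strip d h) x.

Lemma measurable_strip_fun d h delta : measurable_fun setT (strip_fun d h delta).
Proof.
apply: measurable_funM => //; apply: measurable_indic; exact: measurable_strip.
Qed.

Lemma measurable_affine d (L : Rd R d -> R) : affine L -> measurable_fun setT L.
Proof.
move=> [a [b Lab]]; rewrite (_ : L = (fun x => dotp a x + b)); last exact/funext.
by apply: measurable_funD => //; exact: measurable_dotp.
Qed.

(** At three points spaced by 1/6 in the first direction, the second difference removes [L] and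
    leaves [delta]. The other coordinates range over a cube of half-side 1/(d+1), small enough for
    all three points to stay in the ball. *)
Lemma strip_integral_lower_bound d (p delta : R) (L : Rd R d.+1 -> R) : 0 <= p ->
  affine L ->
  (((chord delta / 4) `^ p * 6^-1)%:E * ((2 * d.+1%:R^-1) ^+ d)%:E <=
   \int[lebesgue_Rd d.+1]_x ((normc (expi (strip_fun d 6^-1 delta x - L x) - 1)%R
     * \1_(@unit_ball R d.+1) x) `^ p)%:E)%E.
Proof.
move=> p0 aL; have mL := measurable_affine _ _ aL.
have [a [b Lab]] := aL.
have r0 : 0 <= d.+1%:R^-1 :> R by rewrite invr_ge0.
rewrite -[X in (_ * X <= _)%E](lebesgue_Rd_cube _ d r0).
apply: slab_lower_bound => //.
- apply/measurable_EFinP.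
  apply: (measurableT_comp (measurable_powR p)).
  apply: measurable_funM; last by apply: measurable_indic; exact: measurable_unit_ball.
  apply: measurable_chord; apply: measurable_funB => //; exact: measurable_strip_fun.
- by move=> x; rewrite lee_fin powR_ge0.
- exact: powR_ge0.
- exact: measurable_cube.
move=> t y /andP[t0 t6] Ay.
(* Here d/(d+1)^2 <= 1/4, which amounts to (d-1)^2 >= 0. *)
have yy : dotp y y <= 4^-1.
  apply: (@le_trans _ _ (\sum_(i < d) (d.+1%:R^-1 ^+ 2))).
    apply: ler_sum => i _; rewrite -expr2 -real_normK ?num_real//.
    by apply: lerXn2r => //; rewrite ?nnegrE//; exact: Ay.
  rewrite sumr_const card_ord -[_ *+ d]mulr_natr exprVn.
  rewrite mulrC ler_pdivrMr ?exprn_gt0// -natr1 -subr_ge0.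
  rewrite (_ : _ - _ = 4^-1 * (d%:R - 1) ^+ 2); last by field.
  by rewrite mulr_ge0// sqr_ge0.
(* With t < 1/6 and k <= 2 the first coordinate is at most 1/2, so the squared norm is at most 1/4 +
   1/4. *)
have inB (k : nat) : (k < 3)%N -> consRd (t + k%:R * 6^-1, y) \in @unit_ball R d.+1.
  move=> k3; rewrite inE/= /unit_ball/= dotp_consRd -[leRHS]sqrtr1 ler_wsqrtr//.
  have k2 : k%:R <= 2 :> R by rewrite ler_nat -ltnS.
  have kr : 0 <= k%:R :> R by [].
  have h1 : 0 <= t + k%:R / 6 by nra.
  have h2 : t + k%:R / 6 <= 2^-1 by lra.
  nra.
(* Only the first of the three points lies in the strip, where the perturbation equals [delta]. *)
have E (k : nat) : (k < 3)%N -> 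
    (normc (expi (strip_fun d 6^-1 delta (consRd (t + k%:R * 6^-1, y)) - L (consRd (t
      + k%:R * 6^-1, y))) - 1)%R
     * \1_(@unit_ball R d.+1) (consRd (t + k%:R * 6^-1, y))) `^ p =
    chord (delta * (k == 0)%:R - L (consRd (t + k%:R * 6^-1, y))) `^ p.
  move=> k3; rewrite indicE inB// mulr1 /chord; congr (normc (expi (_ - _) - 1) `^ _).
  rewrite /strip_fun indicE /consRd; congr (_ * _%:R).
  rewrite (_ : (_ \in _) = (0 <= t + k%:R * 6^-1 < 6^-1)); last first.
    by apply/idP/idP => [/set_mem|H]; last apply/mem_set; rewrite /strip/= tnth0.
  case: k k3 => [|k] _; first by rewrite mul0r addr0 t0 t6.
  congr nat_of_bool; rewrite [RHS](_ : _ = false)//; apply/negbTE;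
    rewrite negb_and -!ltNge -leNgt; apply/orP; right.
  by rewrite -[k.+1%:R]natr1; have : 0 <= k%:R :> R by []; lra.
rewrite sumEFin lee_fin !big_ord_recl big_ord0 addr0 /= /bump/= !E// !eqxx/= !mulr0
  mulr1.
set x0 := delta - _; set x1 := 0 - _; set x2 := 0 - _.
have -> : delta = x0 - 2 * x1 + x2.
  rewrite /x0 /x1 /x2 !Lab; case/tupleP: a {Lab} => a0 a'.
  rewrite -[X in dotp X _]/(consRd (a0, a')) !dotp_consRd.
  move: (dotp a' y) => D; rewrite !addn0 -[(1 + 1)%N]/2%N mul0r addr0 mul1r.
  by field.
clearbody x0 x1 x2; have := chord_second_difference p x0 x1 x2 p0.
by rewrite -(addrA (chord x0 `^ p)).
Qed.

Lemma strip_LnormC_lower_bound d (p n delta : R) (L : Rd R d.+1 -> R) :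
  0 < p -> 0 < n -> affine L ->
  (((6^-1 * (2 * d.+1%:R^-1) ^+ d) `^ (n / p) * (chord delta / 4) `^ n)%:E <=
  LnormC (@unit_ball R d.+1) p (fun x => (expi (strip_fun d 6^-1 delta x - L x) -
    1)%R) `^ n)%E.
Proof.
move=> p0 n0 aL; rewrite /LnormC.
have := strip_integral_lower_bound d p delta L (ltW p0) aL.
set N := Lnorm _ _ _ => lb.
have NE : (N `^ p = \int[lebesgue_Rd d.+1]_x ((normc (expi (strip_fun d 6^-1 delta x
  - L x) - 1)%R
     * \1_(@unit_ball R d.+1) x) `^ p)%:E)%E.
  rewrite /N [LHS](powR_Lnorm _ _ (lt0r_neq0 p0)); apply: eq_integral => x _.
  by rewrite abse_EFin ger0_norm ?mulr_ge0 ?normc_ge0.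
set K := (_ * _)%E in lb.
(* The integral bound concerns the p-th power of the norm; writing n = p e turns it into a bound for
   the n-th power. *)
have [e [e0 nE]] : exists e, 0 <= e /\ n = p * e.
  by exists (n / p); split; [rewrite divr_ge0// ltW|rewrite mulrC divfK// lt0r_neq0].
rewrite nE (_ : p * e / p = e); last by rewrite mulrC mulKf// lt0r_neq0.
rewrite [(N `^ _)%E]poweRrM NE.
have K0 : 0 <= 6^-1 * (2 * d.+1%:R^-1) ^+ d :> R by rewrite mulr_ge0 ?exprn_ge0//
  mulr_ge0.
apply: (@le_trans _ _ (K `^ e)%E).
  rewrite /K -EFinM poweR_EFin lee_fin.
  by rewrite -[in leRHS]mulrA [leRHS]powRM ?powR_ge0// -powRrM mulrC.
apply: gt0_ler_poweR => //; rewrite in_itv/= leey andbT.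
- by rewrite /K -EFinM lee_fin !mulr_ge0 ?powR_ge0 ?exprn_ge0 ?mulr_ge0.
- by apply: integral_ge0 => x _; rewrite lee_fin powR_ge0.
Qed.

End strip.

(** * Expansion of the Fourier norm at the indicator of the ball *)

Section fourier.
Context {R : realType}.
Notation normc := ComplexField.Normc.normc.

Lemma cubic_indic_ball d : cubic d (\1_(@unit_ball R d) : Rd R d -> R).
Proof.
split; first split.
- apply: measurable_indic; exact: measurable_unit_ball.
- by exists 1 => x; rewrite indicE; case: (_ \in _); rewrite ?normr1 ?normr0.
- by move=> x xQ; rewrite indicE memNset// => /unit_ball_cube.
Qed.

Lemma cubic_Rintegral_le d (f : Rd R d -> R) (M : R) :
  cubic d f -> (forall x, `|f x| <= M) -> `|\int[lebesgue_Rd d]_x f x| <= M * 2 ^+ d.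
Proof.
move=> cf fM; have [bf f0] := cf.
have -> : \int[lebesgue_Rd d]_x f x = \int[lebesgue_Rd d]_(x in cube 1 d) f x.
  rewrite [RHS]Rintegral_mkcond; congr Rintegral; apply/funext => x.
  rewrite patchE; case: ifPn => // /negP; rewrite inE.
  by move=> /f0.
have mQ := @measurable_cube R 1 d.
have Qy : (lebesgue_Rd d (cube (1 : R) d) < +oo)%E.
  by rewrite [X in (X < _)%E](@lebesgue_Rd_cube1 R d) ltry.
have If : (lebesgue_Rd d).-integrable (cube (1 : R) d) (EFin \o f).
  exact: bmeas_integrable.
apply: le_trans (le_normr_Rintegral mQ If) _.
have <- : \int[lebesgue_Rd d]_(x in cube (1 : R) d) M = M * 2 ^+ d.
  by rewrite Rintegral_cst// [X in fine X](@lebesgue_Rd_cube1 R d).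
apply: le_Rintegral => //.
- exact: integrable_norm.
- by apply: bmeas_integrable => //; exact: bmeas_cst.
Qed.

Lemma cosT_le d (f : Rd R d -> R) (M : R) xi :
  cubic d f -> (forall x, `|f x| <= M) -> `|cosT d f xi| <= M * 2 ^+ d.
Proof.
move=> cf fM; apply: cubic_Rintegral_le; first by apply: cubicM => //;
  exact: bmeas_cos_phase.
by move=> x; rewrite normrM -[leRHS]mul1r; apply: ler_pM => //; exact: cos_max.
Qed.

Lemma sinT_le d (f : Rd R d -> R) (M : R) xi :
  cubic d f -> (forall x, `|f x| <= M) -> `|sinT d f xi| <= M * 2 ^+ d.
Proof.
move=> cf fM; apply: cubic_Rintegral_le; first by apply: cubicM => //;
  exact: bmeas_sin_phase.
by move=> x; rewrite normrM -[leRHS]mul1r; apply: ler_pM => //; exact: sin_max.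
Qed.

Lemma cosTB d (f g : Rd R d -> R) xi : cubic d f -> cubic d g ->
  cosT d (fun x => f x - g x) xi = cosT d f xi - cosT d g xi.
Proof.
move=> cf cg; rewrite /cosT; under eq_Rintegral do rewrite mulrBr.
by rewrite RintegralB//; apply: cubic_integrable; apply: cubicM => //;
  exact: bmeas_cos_phase.
Qed.

Lemma sinTB d (f g : Rd R d -> R) xi : cubic d f -> cubic d g ->
  sinT d (fun x => f x - g x) xi = sinT d f xi - sinT d g xi.
Proof.
move=> cf cg; rewrite /sinT; under eq_Rintegral do rewrite mulrBr.
by rewrite RintegralB//; apply: cubic_integrable; apply: cubicM => //;
  exact: bmeas_sin_phase.
Qed.

Lemma fourierE d (u v : Rd R d -> R) xi : cubic d u -> cubic d v ->
  fourier (fun x => (u x +i* v x)%C) xi =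
  ((cosT d u xi + sinT d v xi) +i* (cosT d v xi - sinT d u xi))%C.
Proof.
move=> cu cv; rewrite /fourier /Cintegral; congr (_ +i* _)%C.
  rewrite /cosT /sinT -RintegralD//.
  - by apply: eq_Rintegral => x _ /=; rewrite cosN sinN mulNr opprK.
  - by apply: cubic_integrable; apply: cubicM => //; exact: bmeas_cos_phase.
  - by apply: cubic_integrable; apply: cubicM => //; exact: bmeas_sin_phase.
rewrite /cosT /sinT -RintegralB//.
- by apply: eq_Rintegral => x _ /=; rewrite cosN sinN mulNr.
- by apply: cubic_integrable; apply: cubicM => //; exact: bmeas_cos_phase.
- by apply: cubic_integrable; apply: cubicM => //; exact: bmeas_sin_phase.
Qed.

Lemma expi_charC d (g : Rd R d -> R) (A : set (Rd R d)) x :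
  (expi (g x) * charC A x)%R = ((cos (g x) * \1_A x) +i* (sin (g x) * \1_A x))%C.
Proof. by rewrite /expi /charC; apply/eqP;
  rewrite eq_complex/= !mulr0 subr0 add0r !eqxx. Qed.

Lemma fourier_expi d (g : Rd R d -> R) xi : measurable_fun setT g ->
  let B := @unit_ball R d in
  let u x := cos (g x) * \1_B x in
  let v x := sin (g x) * \1_B x in
  fourier (fun x => (expi (g x) * charC B x)%R) xi =
  ((cosT d u xi + sinT d v xi) +i* (cosT d v xi - sinT d u xi))%C.
Proof.
move=> mg B u v; rewrite -fourierE.
- by congr (fourier _ _); apply/funext => x; exact: expi_charC.
- by apply: cubicM; [exact: bmeas_cos|exact: cubic_indic_ball].
- by apply: cubicM; [exact: bmeas_sin|exact: cubic_indic_ball].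
Qed.

Lemma fourier_ball d xi :
  fourier (charC (@unit_ball R d)) xi =
  (cosT d (\1_(@unit_ball R d)) xi +i* - sinT d (\1_(@unit_ball R d)) xi)%C.
Proof.
have m0 : measurable_fun setT (fun _ : Rd R d => 0 : R) by exact: measurable_cst.
have c0 : cubic d (fun _ : Rd R d => 0 : R) by split => //; exact: bmeas_cst.
have z0 k : \int[lebesgue_Rd d]_x (k x * (0 : R)) = 0.
  by under eq_Rintegral do rewrite mulr0; rewrite Rintegral_cst// mul0r.
rewrite (_ : charC _ = (fun x => (\1_(@unit_ball R d) x +i* 0)%C)).
  rewrite (fourierE d (\1_(@unit_ball R d)) (fun=> 0))//; last exact: cubic_indic_ball.
  by rewrite /sinT /cosT !z0 addr0 add0r.
by apply/funext => x.
Qed.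

(** Young's inequality for [x] and [y ^ (q - 1)], with conjugate exponents q and q/(q-1), multiplied
    by [q]. *)
Lemma powR_tangent (q x y : R) : 1 < q -> 0 <= x -> 0 <= y ->
  y `^ q + q * y `^ (q - 1) * (x - y) <= x `^ q.
Proof.
move=> q1 x0 y0.
have q0 : 0 < q by lra.
have q10 : 0 < q - 1 by lra.
have := @conjugate_powR R x (y `^ (q - 1)) q (q / (q - 1)) x0 (powR_ge0 _ _) q0.
rewrite divr_gt0// invf_div => /(_ isT).
have -> : q^-1 + (q - 1) / q = 1 by field; rewrite lt0r_neq0.
move=> /(_ erefl); rewrite -powRrM.
have -> : (q - 1) * (q / (q - 1)) = q by field; rewrite lt0r_neq0.
have yq : y `^ (q - 1) * y = y `^ q.
  have [->|yn0] := eqVneq y 0; first by rewrite mulr0 powR0// lt0r_neq0.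
  by rewrite -{2}[y]powRr1// -powRD ?subrK// (negbTE yn0) implybT.
rewrite -(ler_pM2l q0) mulrDr.
have -> : q * (x `^ q / q) = x `^ q by field; rewrite lt0r_neq0.
have -> : q * (y `^ q * ((q - 1) / q)) = (q - 1) * y `^ q by field; rewrite lt0r_neq0.
move=> H.
have -> : q * y `^ (q - 1) * (x - y) = q * (x * y `^ (q - 1)) - q * y `^ q.
  by rewrite -yq; ring.
by lra.
Qed.

(** The two tangent inequalities at [z] are added, so only [w1 + w2] matters, and the error 2 q k
    z^(q-1) remains. *)
Lemma two_sided_powR (q k V z w1 w2 : R) : 3 < q -> 0 <= k -> 0 <= z <= V ->
  0 <= w1 -> 0 <= w2 -> 2 * (z - k) <= w1 + w2 ->
  2 * z `^ q <= w1 `^ q + w2 `^ q + 2 * q * k * V `^ (q - 3) * z ^+ 2.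
Proof.
move=> q3 k0 /andP[z0 zV] w10 w20 H.
have q1 : 1 < q by lra.
have t1 := powR_tangent q w1 z q1 w10 z0.
have t2 := powR_tangent q w2 z q1 w20 z0.
have zq0 : 0 <= z `^ (q - 1) := powR_ge0 _ _.
(* Split z^(q-1) = z^(q-3) z^2; as q > 3, the first factor is increasing in [z]. *)
have zq : z `^ (q - 1) <= V `^ (q - 3) * z ^+ 2.
  have [->|zn0] := eqVneq z 0.
    by rewrite powR0 ?expr0n ?mulr0// lt0r_neq0//; lra.
  rewrite (_ : q - 1 = (q - 3) + 2%:R); last by ring.
  rewrite powRD; last by rewrite (negbTE zn0) implybT.
  rewrite powR_mulrn//; apply: ler_wpM2r; first exact: sqr_ge0.
  apply: ge0_ler_powR => //; rewrite ?nnegrE//; lra.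
have h1 : q * z `^ (q - 1) * (2 * (z - k)) <= q * z `^ (q - 1) * (w1 + w2).
  by apply: ler_wpM2l => //; rewrite mulr_ge0//; lra.
have h2 : 2 * q * k * z `^ (q - 1) <= 2 * q * k * (V `^ (q - 3) * z ^+ 2).
  by apply: ler_wpM2l => //; rewrite !mulr_ge0//; lra.
nra.
Qed.

End fourier.

(** * Energy of the two perturbed transforms, and comparison of exponents *)

Section energy.
Context {R : realType}.
Notation normc := ComplexField.Normc.normc.

Lemma cosTN d (f : Rd R d -> R) xi : cubic d f ->
  cosT d (fun x => - f x) xi = - cosT d f xi.
Proof.
move=> cf; rewrite /cosT -mulN1r -RintegralZl//.
  by apply: eq_Rintegral => x _; rewrite mulN1r mulrN.
by apply: cubic_integrable; apply: cubicM => //; exact: bmeas_cos_phase.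
Qed.

Lemma sinTN d (f : Rd R d -> R) xi : cubic d f ->
  sinT d (fun x => - f x) xi = - sinT d f xi.
Proof.
move=> cf; rewrite /sinT -mulN1r -RintegralZl//.
  by apply: eq_Rintegral => x _; rewrite mulN1r mulrN.
by apply: cubic_integrable; apply: cubicM => //; exact: bmeas_sin_phase.
Qed.

Lemma normc_le_abs (x y : R) : normc (x +i* y)%C <= `|x| + `|y|.
Proof.
rewrite /= -[leRHS]ger0_norm ?addr_ge0// -sqrtr_sqr ler_wsqrtr// sqrrD !real_normK
  ?num_real//.
by rewrite addrAC lerDl mulrn_wge0// mulr_ge0.
Qed.

Lemma fourier_ball_le d xi :
  normc (fourier (charC (@unit_ball R d)) xi) <= 2 * 2 ^+ d.
Proof.
rewrite fourier_ball; apply: le_trans (normc_le_abs _ _) _; rewrite normrN.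
have cB := @cubic_indic_ball R d.
have B1 x : `|\1_(@unit_ball R d) x| <= 1 :> R.
  by rewrite indicE; case: (_ \in _); rewrite ?normr1 ?normr0.
have := cosT_le d _ 1 xi cB B1; have := sinT_le d _ 1 xi cB B1.
by lra.
Qed.

(** Since e^(ig) + e^(-ig) = 2 - 2 (1 - cos g), the first-order terms cancel. The remainder [r] is
    at most [k] on a cube of volume 2^d, and its transform at most 2 k 2^d, counting [cosT] and
    [sinT] separately. *)
Lemma fourier_expi_two_sided d (g : Rd R d -> R) (k : R) xi : measurable_fun setT g ->
  (forall x, 1 - cos (g x) <= k) ->
  2 * (normc (fourier (charC (@unit_ball R d)) xi) - 2 * (k * 2 ^+ d)) <=
  normc (fourier (fun x => (expi (g x) * charC (@unit_ball R d) x)%R) xi) +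
  normc (fourier (fun x => (expi (- g x) * charC (@unit_ball R d) x)%R) xi).
Proof.
move=> mg gk; pose B := @unit_ball R d.
have mNg : measurable_fun setT (fun x => - g x) by exact: measurable_funN.
rewrite fourier_ball (fourier_expi d g)// (fourier_expi d (fun x => - g x))//.
have cB := @cubic_indic_ball R d.
pose u x := cos (g x) * \1_B x; pose v x := sin (g x) * \1_B x.
pose r x := (1 - cos (g x)) * \1_B x.
have cu : cubic d u by apply: cubicM => //; exact: bmeas_cos.
have cv : cubic d v by apply: cubicM => //; exact: bmeas_sin.
have cr : cubic d r.
  apply: cubicM => //; apply: bmeasD; first exact: bmeas_cst.
  by apply: bmeasN; exact: bmeas_cos.
have -> : (fun x => cos (- g x) * \1_(@unit_ball R d) x) = u.
  by apply/funext => x; rewrite cosN.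
have -> : (fun x => sin (- g x) * \1_(@unit_ball R d) x) = (fun x => - v x).
  by apply/funext => x; rewrite sinN mulNr.
rewrite -/u -/v cosTN// sinTN//.
set p := cosT d u xi; set s := sinT d u xi; set cV := cosT d v xi;
  set sV := sinT d v xi.
have ru x : u x = \1_B x - r x by rewrite /u /r; ring.
have uE : u = fun x => \1_B x - r x by apply/funext.
have pE : cosT d (\1_B) xi = p + cosT d r xi by rewrite /p uE cosTB// subrK.
have sE : sinT d (\1_B) xi = s + sinT d r xi by rewrite /s uE sinTB// subrK.
have rk x : `|r x| <= k.
  have c1 := cos_max (g x); have c2 := cos_le1 (g x).
  rewrite /r normrM ger0_norm; last by lra.
  apply: le_trans (gk x); rewrite indicE; case: (_ \in _); rewrite ?normr1 ?normr0; lra.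
have h1 : normc (cosT d (\1_B) xi +i* - sinT d (\1_B) xi)%C <=
    normc (p +i* - s)%C + 2 * (k * 2 ^+ d).
  rewrite pE sE (_ : (_ +i* _)%C = (p +i* - s)%C + (cosT d r xi +i* - sinT d r xi)%C).
    apply: le_trans (le_normcD _ _) _; rewrite lerD2l.
    apply: le_trans (normc_le_abs _ _) _; rewrite normrN.
    by have := cosT_le d r k xi cr rk; have := sinT_le d r k xi cr rk; lra.
  by rewrite opprD.
(* In the sum of the two transforms the contributions [cV] and [sV] of the sine cancel. *)
have h2 : normc (p +i* - s)%C *+ 2 <= normc ((p + sV) +i* (cV - s))%C + normc ((p + -
  sV) +i* (- cV - s))%C.
  rewrite -normcMn (_ : (p +i* - s)%C *+ 2 = ((p + sV) +i* (cV - s))%C + ((p + - sV)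
    +i* (- cV - s))%C).
    exact: le_normcD.
  rewrite mulr2n; apply/eqP; rewrite eq_complex/=; apply/andP; split; apply/eqP; ring.
rewrite mulr2n in h2; rewrite -/B.
lra.
Qed.

Lemma LnormC_powR d (q : R) (f : Rd R d -> R[i]) : q != 0 ->
  (LnormC setT q f `^ q = \int[lebesgue_Rd d]_x (normc (f x) `^ q)%:E)%E.
Proof.
move=> q0; rewrite /LnormC [LHS](powR_Lnorm _ _ q0); apply: eq_integral => x _.
by rewrite abse_EFin indicT mulr1 ger0_norm ?normc_ge0.
Qed.

Lemma measurable_normc_fourier d (u v : Rd R d -> R) : cubic d u -> cubic d v ->
  measurable_fun setT (fun xi => normc (fourier (fun x => (u x +i* v x)%C) xi)).
Proof.
move=> cu cv; have [[mu _] _] := cu; have [[mv _] _] := cv.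
under eq_fun do rewrite fourierE//=.
apply: measurableT_comp; first exact: (continuous_measurable_fun (@sqrt_continuous R)).
apply: measurable_funD; apply: measurable_funX.
- by apply: measurable_funD; [exact: measurable_cosT|exact: measurable_sinT].
- by apply: measurable_funB; [exact: measurable_cosT|exact: measurable_sinT].
Qed.

Lemma measurable_normc_fourier_expi d (g : Rd R d -> R) : measurable_fun setT g ->
  measurable_fun setT
    (fun xi => normc (fourier (fun x => (expi (g x) * charC (@unit_ball R d) x)%R) xi)).
Proof.
move=> mg; have cB := @cubic_indic_ball R d.
under eq_fun do under eq_fun do rewrite expi_charC.
by apply: measurable_normc_fourier; apply: cubicM => //;
  [exact: bmeas_cos|exact: bmeas_sin].
Qed.

Lemma measurable_normc_fourier_ball d :
  measurable_fun setT (fun xi => normc (fourier (charC (@unit_ball R d)) xi)).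
Proof.
have cB := @cubic_indic_ball R d.
have c0 : cubic d (fun _ : Rd R d => 0 : R) by split => //; exact: bmeas_cst.
exact: (measurable_normc_fourier d _ _ cB c0).
Qed.

Lemma fourier_ball_L2 d :
  (\int[lebesgue_Rd d]_xi (normc (fourier (charC (@unit_ball R d)) xi) ^+ 2)%:E <
    +oo)%E.
Proof.
have cB := @cubic_indic_ball R d.
have -> : (\int[lebesgue_Rd d]_xi (normc (fourier (charC (@unit_ball R d)) xi) ^+
  2)%:E =
  \int[lebesgue_Rd d]_xi (cosT d (\1_(@unit_ball R d)) xi ^+ 2 +
                          sinT d (\1_(@unit_ball R d)) xi ^+ 2)%:E)%E.
  apply: eq_integral => xi _.
  by rewrite fourier_ball/= sqrrN sqr_sqrtr// addr_ge0// sqr_ge0.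
apply: le_lt_trans (plancherel d _ cB) _.
apply: lte_mul_pinfty; rewrite ?lee_fin ?exprn_ge0//.
have : cubic d (fun x => \1_(@unit_ball R d) x ^+ 2 : R).
  by under eq_fun do rewrite expr2; apply: cubicM => //; case: cB.
move=> /cubic_integrable/integrableP[_]; congr (_ < _)%E.
by apply: eq_integral => x _ /=; rewrite ger0_norm// sqr_ge0.
Qed.

Lemma fourier_ball_Lq d (q : R) : 3 < q ->
  (\int[lebesgue_Rd d]_xi (normc (fourier (charC (@unit_ball R d)) xi) `^ q)%:E <
    +oo)%E.
Proof.
move=> q3; set V : R := 2 * 2 ^+ d.
have mz := measurable_normc_fourier_ball d.
have V0 : 0 <= V by rewrite mulr_ge0// exprn_ge0.
apply: (@le_lt_trans _ _ (\int[lebesgue_Rd d]_xi ((q * V * V `^ (q - 3))%:E *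
  (normc (fourier (charC (@unit_ball R d)) xi) ^+ 2)%:E))%E); last first.
  rewrite ge0_integralZl//.
  - apply: lte_mul_pinfty; rewrite ?fourier_ball_L2// lee_fin.
    by rewrite !mulr_ge0 ?powR_ge0//; lra.
  - by apply/measurable_EFinP; exact: measurable_funX.
  - by move=> x _; rewrite lee_fin sqr_ge0.
  - by rewrite lee_fin !mulr_ge0 ?powR_ge0//; lra.
apply: ge0_le_integral => //.
- by move=> x _; rewrite lee_fin powR_ge0.
- apply/measurable_EFinP; exact: (measurableT_comp (measurable_powR q)).
- apply: emeasurable_funM => //; apply/measurable_EFinP; exact: measurable_funX.
move=> xi _; rewrite -EFinM lee_fin.
have zV := fourier_ball_le d xi;
  have z0 := normc_ge0 (fourier (charC (@unit_ball R d)) xi).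
set z := normc _ in zV z0 *.
(* With [w1 = w2 = 0] and [k = V], the hypothesis is z <= V and the conclusion bounds z^q by a
   multiple of z^2. *)
have H := @two_sided_powR R q V V z 0 0 q3 V0.
have : 2 * z `^ q <= 0 `^ q + 0 `^ q + 2 * q * V * V `^ (q - 3) * z ^+ 2.
  by apply: H; rewrite ?z0 ?zV//; rewrite -/V in zV; lra.
rewrite powR0; last by rewrite lt0r_neq0//; lra.
by lra.
Qed.

(** The pointwise inequality [two_sided_powR] integrated over the frequency. The error is added on
    the right, so no extended reals are subtracted. *)
Lemma fourier_energy_two_sided d (q k : R) (g : Rd R d -> R) :
  3 < q -> 0 <= k -> measurable_fun setT g -> (forall x, 1 - cos (g x) <= k) ->
  (2%:E * \int[lebesgue_Rd d]_xi (normc (fourier (charC (@unit_ball R d)) xi) `^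
    q)%:E <=
   (\int[lebesgue_Rd d]_xi
      (normc (fourier (fun x => (expi (g x) * charC (@unit_ball R d) x)%R) xi) `^ q)%:E
   + \int[lebesgue_Rd d]_xi
      (normc (fourier (fun x => (expi (- g x) * charC (@unit_ball R d) x)%R) xi) `^
        q)%:E)
   + (2 * q * (2 * (k * 2 ^+ d)) * (2 * 2 ^+ d) `^ (q - 3))%:E *
     \int[lebesgue_Rd d]_xi (normc (fourier (charC (@unit_ball R d)) xi) ^+ 2)%:E)%E.
Proof.
move=> q3 k0 mg gk.
have mNg : measurable_fun setT (fun x => - g x) by exact: measurable_funN.
set D := 2 * q * _ * _.
have D0 : 0 <= D by rewrite /D !mulr_ge0 ?powR_ge0 ?exprn_ge0//; lra.
have mpow (h : Rd R d -> R) : measurable_fun setT h ->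
    measurable_fun setT (fun x => (h x `^ q)%:E).
  by move=> mh; apply/measurable_EFinP; exact: (measurableT_comp (measurable_powR q)).
have mz := measurable_normc_fourier_ball d.
have mw1 := measurable_normc_fourier_expi d g mg.
have mw2 := measurable_normc_fourier_expi d (fun x => - g x) mNg.
have mz2 : measurable_fun setT
    (fun xi => (normc (fourier (charC (@unit_ball R d)) xi) ^+ 2)%:E).
  by apply/measurable_EFinP; exact: measurable_funX.
have p0 (x : R) : (0 <= (x `^ q)%:E)%E by rewrite lee_fin powR_ge0.
have s0 (x : R) : (0 <= (x ^+ 2)%:E)%E by rewrite lee_fin sqr_ge0.
rewrite -!ge0_integralZl//; try exact: mpow.
rewrite -!ge0_integralD//; try exact: mpow; first last.
- exact: emeasurable_funM.
- by move=> x _; rewrite mule_ge0.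
- by apply: emeasurable_funD; exact: mpow.
- by move=> x _; rewrite adde_ge0.
apply: ge0_le_integral => //.
- by move=> x _; rewrite mule_ge0.
- by apply: emeasurable_funM => //; exact: mpow.
- apply: emeasurable_funD; last exact: emeasurable_funM.
  by apply: emeasurable_funD; exact: mpow.
move=> xi _; rewrite -!EFinM -!EFinD lee_fin.
apply: two_sided_powR => //; rewrite ?normc_ge0 ?fourier_ball_le//.
- by rewrite !mulr_ge0// exprn_ge0.
- exact: fourier_expi_two_sided.
Qed.

(** If n < 2, dividing by e^n gives a <= D e^(2-n), which fails for small [e]. *)
Lemma exponent_ge2 (a D n : R) : 0 < a ->
  (forall e : R, 0 < e <= 4^-1 -> a * e `^ n <= D * e ^+ 2) -> 2 <= n.
Proof.
move=> a0 H; rewrite leNgt; apply/negP => n2.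
pose D1 := `|D| + 1; have D10 : 0 < D1 by rewrite /D1 ltr_wpDl.
pose t := 2 - n; have t0 : 0 < t by rewrite /t; lra.
(* Chosen so that e^t <= b makes the right side at most half of the left; [D1] is positive whatever
   the sign of [D]. *)
pose b := a / (2 * D1); have b0 : 0 < b by rewrite divr_gt0// mulr_gt0.
pose e := Num.min 4^-1 (b `^ t^-1).
have e0 : 0 < e by rewrite lt_min invr_gt0 ltr0n powR_gt0.
have et : e `^ t <= b.
  have -> : b = (b `^ t^-1) `^ t by rewrite -powRrM mulVf ?powRr1 ?lt0r_neq0// ltW.
  apply: ge0_ler_powR; rewrite ?nnegrE ?powR_ge0//; [exact: ltW|exact: ltW|].
  by rewrite ge_min lexx orbT.
have := H e; rewrite e0 ge_min lexx /= => /(_ isT).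
have -> : e ^+ 2 = e `^ n * e `^ t.
  rewrite -powRD ?(gt_eqF e0) ?implybT// (_ : n + t = 2%:R) ?powR_mulrn ?ltW//.
  by rewrite /t; ring.
have en0 : 0 < e `^ n by rewrite powR_gt0.
have DD : D <= D1 by rewrite /D1; have := ler_norm D; lra.
have h1 : D * (e `^ n * e `^ t) <= D1 * (e `^ n * b).
  apply: (@le_trans _ _ (D1 * (e `^ n * e `^ t))).
    by apply: ler_wpM2r => //; rewrite mulr_ge0// powR_ge0.
  by apply: ler_wpM2l; [exact: ltW|apply: ler_wpM2l => //; exact: ltW].
have h2 : D1 * (e `^ n * b) = a * e `^ n / 2 by rewrite /b; field; rewrite lt0r_neq0.
have : 0 < a * e `^ n by rewrite mulr_gt0.
by lra.
Qed.

End energy.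

(** * Comparison of the orders in the size of the perturbation *)

Theorem lemma8p4 (R : realType) (d qbar : nat)
    (hd : (1 <= d)%N) (hqbar : (4 <= qbar)%N) (qbar_even : ~~ odd qbar) :
  exists rho : R, 0 < rho /\
    forall p n : R, 1 <= p -> 0 < n ->
    (exists q : R, [/\ 3 < q, `|q - qbar%:R| < rho &
      exists c : R, 0 < c /\
        forall g : Rd R d -> R, measurable_fun [set: Rd R d] g ->
          (LnormC setT q
             (fourier (fun x => (expi (g x) * charC (@unit_ball R d) x)%R))
             `^ q
           <= LnormC setT q (fourier (charC (@unit_ball R d))) `^ q
              - c%:E * ereal_inf
                  [set LnormC (@unit_ball R d) p
                         (fun x => (expi (g x - L x) - 1)%R) `^ n
                    | L in [set L : Rd R d -> R | affine L]])%E]) ->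
    2 <= n.
Proof.
exists 1; split => // p n p1 n0 [q [q3 _ [c [c0 H]]]].
(* The dimension is written as a successor, so that there is a first coordinate for the strip. *)
case: d hd H => // d _ H.
have p0 : 0 < p by lra.
have q0 : q != 0 by rewrite lt0r_neq0//; lra.
(* Both integrals of the unperturbed transform are finite, so the final inequality can be read in
   the reals. *)
have [Z ZE] : exists Z : R, (\int[lebesgue_Rd d.+1]_xi
    (ComplexField.Normc.normc (fourier (charC (@unit_ball R d.+1)) xi) `^ q)%:E =
      Z%:E)%E.
  eexists; rewrite -[LHS]fineK// ge0_fin_numE ?fourier_ball_Lq//.
  by apply: integral_ge0 => x _; rewrite lee_fin powR_ge0.
have [P PE] : exists P : R, (\int[lebesgue_Rd d.+1]_xi
    (ComplexField.Normc.normc (fourier (charC (@unit_ball R d.+1)) xi) ^+ 2)%:E =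
      P%:E)%E.
  eexists; rewrite -[LHS]fineK// ge0_fin_numE ?fourier_ball_L2//.
  by apply: integral_ge0 => x _; rewrite lee_fin sqr_ge0.
pose A := (6^-1 * (2 * d.+1%:R^-1) ^+ d) `^ (n / p) : R.
have A0 : 0 < A.
  by rewrite powR_gt0// mulr_gt0 ?exprn_gt0 ?mulr_gt0 ?invr_gt0 ?ltr0n.
have bound delta : (\int[lebesgue_Rd d.+1]_xi (ComplexField.Normc.normc
    (fourier (fun x => (expi (strip_fun d 6^-1 delta x) * charC (@unit_ball R d.+1)
      x)%R) xi) `^ q)%:E
    <= (Z - c * (A * (chord delta / 4) `^ n))%:E)%E.
  have := H _ (measurable_strip_fun d 6^-1 delta).
  rewrite [X in (X <= _)%E](LnormC_powR _ q _ q0).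
  rewrite [X in (_ <= X - _)%E](LnormC_powR _ q _ q0) [X in (_ <= X - _)%E]ZE =>
    /le_trans; apply.
  rewrite EFinB leeB// EFinM lee_pmul2l ?ltry ?fin_numE//.
  (* The lower bound is uniform in [L], so it passes to the infimum. *)
  apply/ereal_infP => _ [L aL <-].
  exact: strip_LnormC_lower_bound.
(* The error constant of [fourier_energy_two_sided] for k = 8 e^2, with e^2 taken out. *)
pose K := 2 * q * (2 * (8 * 2 ^+ d.+1)) * (2 * 2 ^+ d.+1) `^ (q - 3) * P.
apply: (@exponent_ge2 R (2 * c * A) K n); first by rewrite !mulr_gt0.
move=> e /andP[e0 e4].
(* This makes chord delta = 4 e, since the square of the chord is 2 (1 - cos delta) = 16 e^2; e <=
   1/4 keeps the argument in [1/2, 1]. *)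
pose delta := acos (1 - 8 * e ^+ 2).
have cosd : cos delta = 1 - 8 * e ^+ 2.
  by rewrite acosK// in_itv/=; apply/andP; split; nra.
have chd : chord delta / 4 = e.
  rewrite chordE cosd (_ : 2 * _ = (4 * e) ^+ 2); last by ring.
  by rewrite sqrtr_sqr ger0_norm; [field|lra].
have NE : (fun x => - strip_fun d 6^-1 delta x) = strip_fun d 6^-1 (- delta).
  by apply/funext => x; rewrite /strip_fun mulNr.
have k0 : 0 <= 8 * e ^+ 2 by rewrite mulr_ge0// sqr_ge0.
have gk x : 1 - cos (strip_fun d 6^-1 delta x) <= 8 * e ^+ 2.
  rewrite /strip_fun indicE; case: (_ \in _); first by rewrite mulr1 cosd; lra.
  by rewrite mulr0 cos0 subrr.
have := fourier_energy_two_sided _ q _ _ q3 k0 (measurable_strip_fun d 6^-1 delta) gk.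
rewrite [X in (2%:E * X)%E]ZE [X in (_ + _ * X)%E]PE.
(* The negative of the perturbation is the strip function of [- delta], with the same chord, so both
   signs obey the same bound. *)
have b1 := bound delta; have b2 := bound (- delta).
rewrite chordN chd in b2; rewrite chd in b1.
have NE' x : - strip_fun d 6^-1 delta x = strip_fun d 6^-1 (- delta) x by rewrite -NE.
under [X in (_ + X + _)%E]eq_integral => xi _.
  under [X in fourier X]eq_fun => x do rewrite NE'.
  over.
move=> /le_trans /(_ (leeD (leeD b1 b2) (lexx _))).
(* The terms 2 Z cancel, leaving 2 c A e^n <= K e^2. *)
rewrite -!EFinM -!EFinD lee_fin /K; lra.
Qed.
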